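(* Let $\mu$ be a computable probability measure on $2^{\mathbb{N}}$, and assume $x_{0}\in2^{\mathbb{N}}$ is not $\mu$-computably random. Then there exists a $\lambda$-almost-everywhere computable measure-preserving map $T\colon(2^{\mathbb{N}},\lambda)\rightarrow(2^{\mathbb{N}},\mu)$ such that $T^{-1}(\{x_{0}\})=\varnothing$ (i.e.\ there is no $x\in\operatorname{dom}T$ with $T(x)=x_0$).
   Context: $2^{\mathbb{N}}$ is Cantor space, $2^{*}$ the set of finite binary strings, $[\sigma]$ the cylinder of sequences extending $\sigma$, and $\mu(\sigma)=\mu([\sigma])$. $\lambda$ is the fair-coin measure, $\lambda(\sigma)=2^{-|\sigma|}$. A finite Borel measure $\mu$ on $2^{\mathbb{N}}$ is computable if $\sigma\mapsto\mu(\sigma)$ is computable. A function $t\colon2^{\mathbb{N}}\to[0,\infty]$ is lower semicomputable if it is the sum of a computable sequence of computable functions $2^{\mathbb{N}}\to[0,\infty)$. $x$ is $\mu$-computably random if $t(x)<\infty$ for every lower semicomputable $t$ and every computable probability measure $\nu$ on $2^{\mathbb{N}}$ with $\int_{[\sigma]}t\,d\mu\le\nu(\sigma)$ for all $\sigma\in2^{*}$. A partial map $T$ is partial computable if given by a partial monotone machine $M\colon2^*\to2^*$ ($x\in\operatorname{dom}T$ iff $\lim_nM(x\upharpoonright_n)$ is an infinite sequence, which is then $T(x)$); it is $\lambda$-a.e.\ computable if moreover $\lambda(\operatorname{dom}T)=1$. $T\colon(2^{\mathbb{N}},\lambda)\to(2^{\mathbb{N}},\mu)$ measure-preserving means $\mu(B)=\lambda(T^{-1}(B))$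 for all Borel $B$. *)

(* Defs.v *)
From HB Require Import structures.
From mathcomp Require Import all_boot all_order all_algebra.
From mathcomp Require Import ring lra.
From mathcomp Require Import all_classical all_reals all_analysis.
From mathcomp Require Import measurable_realfun.

Set Implicit Arguments.
Unset Strict Implicit.
Unset Printing Implicit Defensive.

Import Order.TTheory GRing.Theory Num.Theory.
Import numFieldNormedType.Exports.

Local Open Scope classical_set_scope.
Local Open Scope ring_scope.

(* The measurable structure is the Borel sigma-algebra of the product topology. *)
Definition cantor : Type := g_sigma_algebraType (@open cantor_space).
HB.instance Definition _ :=
  Measurable.copy cantor (g_sigma_algebraType (@open cantor_space)).

Definition restr (x : cantor) (n : nat) : seq bool := mkseq x n.

Definition cyl (s : seq bool) : set cantor := [set x | restr x (size s) = s].

(* Partial recursive functionals in the sense of Kleene. Arities are not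
   tracked: missing arguments read as 0, which does not enlarge the class of
   computable functions. *)
Inductive prf : Type :=
| Zero
| Succ
| Proj of nat
| Oracle
| Comp (m : nat) of prf & ('I_m -> prf)
| PrimRec of prf & prf
| Mu of prf.

(* [eval x c v r]: program [c] with oracle [x] halts on arguments [v] with
   output [r]. *)
Fixpoint eval (x : nat -> bool) (c : prf) (v : seq nat) (r : nat) : Prop :=
  match c with
  | Zero => r = 0%N
  | Succ => r = (head 0%N v).+1
  | Proj i => r = nth 0%N v i
  | Oracle => r = x (head 0%N v)
  | Comp m f g => exists w : 'I_m -> nat,
      (forall i, eval x (g i) v (w i)) /\ eval x f [seq w i | i <- enum 'I_m] r
  | PrimRec f g => exists h : nat -> nat,
      [/\ eval x f (behead v) (h 0%N),
          forall i, (i < head 0 v)%N ->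
            eval x g [:: i, h i & behead v] (h i.+1)
        & r = h (head 0%N v)]
  | Mu f => eval x f (r :: v) 0%N /\
      forall i, (i < r)%N -> exists k, eval x f (i :: v) k.+1
  end.

Lemma eval_functional x c v r r' : eval x c v r -> eval x c v r' -> r = r'.
Proof.
elim: c v r r' => [||i||m f IHf g IHg|f IHf g IHg|f IHf] v r r' /=;
  try by move=> -> ->.
- move=> [w [gw fw]] [w' [gw' fw']]; apply: (IHf _ _ _ fw).
  have -> // : w = w' by apply/funext => i; exact: IHg (gw i) (gw' i).
- move=> [h [h0 hS ->]] [h' [h0' hS' ->]].
  suff H i : (i <= head 0 v)%N -> h i = h' i by exact: H.
  elim: i => [_|i IHi lti]; first exact: IHf h0 h0'.
  have := hS' i lti; rewrite -IHi ?(ltnW lti)// => /(IHg _ _ _ (hS i lti)).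
  by [].
- move=> [fr lt_r] [fr' lt_r'].
  case: (ltngtP r r') => // [/lt_r'|/lt_r] [k fk].
  + by have := IHf _ _ _ fr fk.
  + by have := IHf _ _ _ fr' fk.
Qed.

Definition eval0 : prf -> seq nat -> nat -> Prop := eval (fun=> false).

(* Bijective base-2 numeration: a bijection between finite strings and nat. *)
Fixpoint str_code (s : seq bool) : nat :=
  if s is b :: s' then ((str_code s').*2 + b).+1 else 0%N.

Lemma str_code_inj : injective str_code.
Proof.
elim=> [|b s IHs] [|b' s'] //= [e].
have eb : b = b' by have /(congr1 odd) := e; rewrite !oddD !odd_double !oddb.
move: e; rewrite eb => /addIn/double_inj/IHs -> //.
Qed.

Lemma str_code_surj n : exists s, str_code s = n.
Proof.
elim/ltn_ind: n => -[_|n IHn]; first by exists [::].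
have [|s es] := IHn n./2; first by rewrite ltnS -divn2 leq_div.
by exists (odd n :: s); rewrite /= es addnC odd_double_half.
Qed.

(* A nonnegative real is approximated at precision k by a dyadic rational
   p / 2^k with p a natural number. *)
Definition dyadic_approx (R : realType) (r : R) (k p : nat) : Prop :=
  `|r - p%:R / 2 ^+ k| <= (2 ^+ k)^-1.

Definition computable_measure (R : realType)
    (mu : {finite_measure set cantor -> \bar R}) : Prop :=
  exists c, forall s k, exists2 p,
    eval0 c [:: str_code s; k] p & dyadic_approx (fine (mu (cyl s))) k p.

(* Computable sequences of computable functions from cantor to [0, +oo[: the
   argument is the oracle of the computation. *)
Definition computable_fun_seq (R : realType) (f : nat -> cantor -> R) : Prop :=
  (forall n x, 0 <= f n x) /\
  exists c, forall n (x : cantor) k, exists2 p,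
    eval x c [:: n; k] p & dyadic_approx (f n x) k p.

Definition lower_semicomputable (R : realType) (t : cantor -> \bar R) : Prop :=
  exists2 f : nat -> cantor -> R, computable_fun_seq f &
    forall x, t x = (\sum_(n <oo) (f n x)%:E)%E.

Definition computably_random (R : realType) (mu : probability cantor R)
    (x : cantor) : Prop :=
  forall (t : cantor -> \bar R) (nu : probability cantor R),
    lower_semicomputable t -> computable_measure nu ->
    (forall s, \int[mu]_(y in cyl s) t y <= nu (cyl s))%E ->
    (t x < +oo)%E.

Definition partial_computable_machine (M : seq bool -> option (seq bool)) :=
  exists c, forall s u, M s = Some u <-> eval0 c [:: str_code s] (str_code u).

Definition monotone_machine (M : seq bool -> option (seq bool)) :=
  forall s s' u u', prefix s s' -> M s = Some u -> M s' = Some u' ->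
    prefix u u'.

(* The limit of M along the prefixes of x is the infinite sequence y. *)
Definition machine_lim (M : seq bool -> option (seq bool)) (x y : cantor) :=
  (forall n u, M (restr x n) = Some u -> cyl u y) /\
  forall k, exists n u, M (restr x n) = Some u /\ (k <= size u)%N.

(* A partial map is a function to [option cantor], undefined where it takes
   the value [None]. *)
Definition partial_computable (T : cantor -> option cantor) : Prop :=
  exists M, [/\ partial_computable_machine M, monotone_machine M &
    forall x y, T x = Some y <-> machine_lim M x y].

Definition pdom (T : cantor -> option cantor) : set cantor :=
  [set x | exists y, T x = Some y].

Definition ppreimage (T : cantor -> option cantor) (B : set cantor) :
  set cantor := [set x | exists2 y, B y & T x = Some y].

Definition ae_computable (R : realType) (P : probability cantor R)
    (T : cantor -> option cantor) : Prop :=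
  partial_computable T /\ P (pdom T) = 1%E.

Definition measure_preserving (R : realType) (P Q : probability cantor R)
    (T : cantor -> option cantor) : Prop :=
  forall B, measurable B ->
    measurable (ppreimage T B) /\ Q B = P (ppreimage T B).

Lemma open_cyl (U : set cantor) (x : cantor) :
  @open cantor_space U -> U x -> exists n, cyl (restr x n) `<=` U.
Proof.
move=> oU Ux; apply: contrapT => /forallNP nU.
have /choice[y yP] : forall n, exists y, cyl (restr x n) y /\ ~ U y.
  by move=> n; have /existsNP[y /not_implyP] := nU n; exists y.
have yx : (y : nat -> cantor_space) @ \oo --> (x : cantor_space).
  apply/pointwise_cvgP => i.
  suff : (fun n => y n i) @ \oo --> x i by [].
  apply: cvg_near_cst; near=> n.
  have ltin : (i < n)%N by near: n; exact: nbhs_infty_gt.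
  have /(congr1 (fun s => nth false s i)) := (yP n).1.
  by rewrite size_mkseq !nth_mkseq.
have /yx : nbhs (x : cantor_space) U by exact: open_nbhs_nbhs.
by move=> [N _ /(_ N (leqnn N))] /= UN; case: (yP N).
Unshelve. all: by end_near. Qed.

Lemma measurable_preimage_cyl d (T : measurableType d) (f : T -> cantor) s :
  (forall n, measurable_fun setT (fun x => f x n)) ->
  measurable (f @^-1` cyl s).
Proof.
move=> mf.
have -> : f @^-1` cyl s = \bigcap_i
    (if (i < size s)%N then (fun x => f x i) @^-1` [set nth false s i]
     else setT).
  apply/seteqP; split => [x /= fx i _ /=|x fx].
    case: ifP => // ilt /=.
    by have := congr1 (fun u => nth false u i) fx; rewrite nth_mkseq.
  apply: (@eq_from_nth _ false); first by rewrite size_mkseq.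
  move=> i; rewrite size_mkseq => ilt; rewrite nth_mkseq //.
  by have := fx i I; rewrite ilt.
apply: bigcapT_measurable => i; case: ifP => // _.
by rewrite -[X in measurable X]setTI; exact: mf.
Qed.

Lemma measurable_fun_cantor d (T : measurableType d) (f : T -> cantor) :
  (forall n, measurable_fun setT (fun x => f x n)) -> measurable_fun setT f.
Proof.
move=> mf.
apply: (@measurability _ _ T cantor setT f (@open cantor_space)) => //.
move=> _ [U oU <-].
rewrite setTI.
have -> : f @^-1` U =
    \bigcup_s (if `[< cyl s `<=` U >] then f @^-1` cyl s else set0).
  apply/seteqP; split => [x /= Ux|x [s _]].
    have [n nU] := open_cyl oU Ux; exists (restr (f x) n) => //.
    by rewrite asboolT //= /cyl /= size_mkseq.
  by case: asboolP => // sU /sU.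
apply: countable_bigcupT_measurable => [|s]; first exact: countableP.
by case: ifP => // _; exact: measurable_preimage_cyl.
Qed.

Section fair_coin.
Context (R : realType).

Definition doubling (r : R) : R := r *+ 2 - (2^-1 <= r)%R%:R.

(* Binary expansion of a real in [0, 1[. *)
Definition binary_digits (r : measurableTypeR R) : cantor :=
  fun n => 2^-1 <= iter n doubling r.

Definition string_val (s : seq bool) : R :=
  foldr (fun (b : bool) v => (b%:R + v) / 2) 0 s.

Lemma string_val_itv s :
  0 <= string_val s /\ string_val s + (2 ^+ size s)^-1 <= 1.
Proof.
elim: s => [|b s [v0 v1]] /=; first by rewrite expr0 invr1 add0r.
rewrite exprS invfM; split; first by rewrite divr_ge0 ?addr_ge0 ?ler0n.
by case: b => /=; lra.
Qed.

Lemma binary_digits_cyl s r : 0 <= r < 1 ->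
  cyl s (binary_digits r) <->
  string_val s <= r < string_val s + (2 ^+ size s)^-1.
Proof.
elim: s r => [|b s IHs] r r01.
  by rewrite /= expr0 invr1 add0r r01; split.
have r'01 : 0 <= doubling r < 1.
  by move: r01; rewrite /doubling; case: (lerP 2^-1 r) => h /=; lra.
have -> : cyl (b :: s) (binary_digits r) <->
    (2^-1 <= r) = b /\ cyl s (binary_digits (doubling r)).
  rewrite /cyl /= /restr -(add1n (size s)) /mkseq iotaD map_cat /=.
  rewrite add0n -[iota 1 _]/(iota (1 + 0) _) iotaDl -map_comp.
  have -> : [seq (binary_digits r \o addn 1) i | i <- iota 0 (size s)] =
      [seq binary_digits (doubling r) i | i <- iota 0 (size s)].
    by apply: eq_map => i /=; rewrite /binary_digits -iterSr.
  split => [[h1 h2]|[h1 h2]]; first by split; [exact: h1|exact: h2].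
  by congr cons; [exact: h1|exact: h2].
rewrite IHs //=.
have [v0 v1] := string_val_itv s.
rewrite exprS invfM; move: v0 v1; set v := string_val s.
have : 0 < (2 ^+ size s : R)^-1 by rewrite invr_gt0 exprn_gt0.
set e := _^-1; rewrite /doubling => e0 v0 v1.
case: (lerP 2^-1 r) => h /=; case: b => /=.
- by split => [[_ /andP[? ?]]|/andP[? ?]]; [|split => //]; lra.
- by split => [[]//|/andP[? ?]]; lra.
- by split => [[]//|/andP[? ?]]; lra.
- by split => [[_ /andP[? ?]]|/andP[? ?]]; [|split => //]; lra.
Qed.

Lemma measurable_binary_digit n :
  measurable_fun setT (fun r => binary_digits r n).
Proof.
apply: measurable_fun_ler => //.
elim: n => [|n IHn]; first exact: measurable_id.
have -> : iter n.+1 doubling = ((fun r => iter n doubling r + iter n doubling r) \-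
    (fun r => if 2^-1 <= iter n doubling r then 1 else 0)).
  by apply/funext => r /=; rewrite /doubling mulr2n; case: ifP.
apply: measurable_funB; first exact: measurable_funD.
by apply: measurable_fun_ifT => //; exact: measurable_fun_ler.
Qed.

Lemma measurable_binary_digits : measurable_fun setT binary_digits.
Proof. apply: measurable_fun_cantor => n; exact: measurable_binary_digit. Qed.

HB.instance Definition _ :=
  isMeasurableFun.Build _ _ _ _ binary_digits measurable_binary_digits.

Definition fair_coin : probability cantor R :=
  distribution (uniform_prob (@ltr01 R)) binary_digits.

Lemma uniform_prob01_itv (a b : R) : 0 <= a -> a <= b -> b <= 1 ->
  uniform_prob (@ltr01 R) `[a, b[ = (b - a)%:E.
Proof.
move=> a0 ab b1; rewrite /uniform_prob.
rewrite (eq_integral (fun=> 1%E)); last first.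
  move=> x; rewrite inE /= in_itv /= => /andP[ax xb].
  by rewrite /uniform_pdf (le_trans a0 ax) (ltW (lt_le_trans xb b1)) subr0 invr1.
rewrite integral_cst //= mul1e lebesgue_measure_itv /= lte_fin.
by case: ltP => // ba; rewrite (@le_anti _ _ a b) ?ab ?subrr // ab.
Qed.

Lemma fair_coin_cyl s : fair_coin (cyl s) = ((2 ^+ size s)^-1)%:E.
Proof.
rewrite /fair_coin /= /distribution /pushforward.
have [v0 v1] := string_val_itv s.
have e0 : 0 < (2 ^+ size s : R)^-1 by rewrite invr_gt0 exprn_gt0.
set P := uniform_prob _; set A := _ @^-1` _.
pose I := `[0, 1[%classic : set R.
have mI : measurable (I : set (measurableTypeR R)) by exact: measurable_itv.
have AI : A `&` I =
    `[string_val s, string_val s + (2 ^+ size s)^-1[%classic.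
  apply/seteqP; split => r /=.
    rewrite /I /= in_itv /= in_itv /= => -[Ar r01].
    by apply/binary_digits_cyl.
  rewrite in_itv /= => /andP[vr rv].
  have r01 : 0 <= r < 1 by lra.
  split; last by rewrite /I /= in_itv.
  by apply/binary_digits_cyl => //; rewrite vr.
have mA : measurable A.
  by apply: measurable_preimage_cyl => n; exact: measurable_binary_digit.
have PI : P (~` I) = 0%E.
  have := probability_setC (P : probability _ R) mI.
  have PI1 : P I = 1%E by rewrite /P /I uniform_prob01_itv // subr0.
  by move=> PIC; apply: (etrans PIC); rewrite [X in (_ - X)%E]PI1 subee.
apply: (etrans (measureDI P mA mI)); rewrite AI.
rewrite [X in (_ + X)%E]uniform_prob01_itv //; last by rewrite lerDl ltW.
have PAI : P (A `\` I) = 0%E.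
  apply: (subset_measure0 _ _ _ PI); first exact: measurableD.
  - exact: measurableC.
  - exact: subIsetr.
by rewrite [X in (X + _)%E]PAI add0e; congr (_%:E); rewrite addrAC subrr add0r.
Qed.

End fair_coin.

(* Main.v *)
Require Import Defs.
From HB Require Import structures.
From mathcomp Require Import all_boot all_order all_algebra.
From mathcomp Require Import zify ring lra.
From mathcomp Require Import all_classical all_reals all_analysis.

(* By continuity of the computable summands of t, t(x0) = oo forces, for every
   C, nu(s) >= C mu(s) for some prefix s of x0. For 0 <= c <= 1, betting along
   nu yields a computable measure R_c of mass c on cylinders such that
   min(mu, c nu) <= R_c <= mu; moreover R_c increases with c, and R_1 = mu.
   Hence mu is the sum of the computable measures
   pi_k = R_(2^-k) - R_(2^-(k+1)), which have mass 2^-(k+1), and each pi_k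
   vanishes on some cylinder around x0. Now T transports Lebesgue measure on
   ]2^-(k+1), 2^-k[ to pi_k by quantiles: s is output once z is certified to lie
   in a subinterval I_k(s) of length pi_k(s). As I_k(s) is empty for some prefix
   s of x0, no z is mapped to x0. *)

(* MathComp-Analysis has its own [eval] and [dyadic_approx]. *)
Import Defs.

Set Implicit Arguments.
Unset Strict Implicit.
Unset Printing Implicit Defensive.

Import Order.TTheory GRing.Theory Num.Theory.

(** * Closure properties of computable functions *)

Local Open Scope nat_scope.

(** The natural candidate min(mu, c nu) is not a measure: its values at the two children of s may
    add up to less than its value at s. R_c hands the surplus to the right child as far as mu
    permits and the rest to the left one, so the total mass stays c. Hence the masses of the pieces
    pi_k are known in advance and their intervals fit side by side in the unit interval. Where mu(s)
    <= 2^-(k+1) nu(s), the bounds squeeze R_(2^-k)(s) and R_(2^-(k+1))(s) to mu(s), so pi_k(s) = 0.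
    T is built from mu and nu alone: the machine never has to locate the cylinders around x0.

    The second obstacle is that computable reals cannot be compared effectively. The machine
    therefore checks, on integer approximations and with a safety margin, that the whole dyadic
    interval of the input read so far lies in I_k(s). This interval has positive length, so an empty
    I_k(s) is never certified, for any input whatsoever, whereas interior points of I_k(s) are
    certified sooner or later. Endpoints may be lost, at the cost of a null set. *)

Lemma map_enum_ord n (F : nat -> nat) :
  map (fun i : 'I_n => F i) (enum 'I_n) = mkseq F n.
Proof. by rewrite /mkseq -val_enum_ord -map_comp. Qed.

(* Arguments come in lists of a fixed length [n], so that the weakening
   [computable_behead] is a finite composition. *)
Definition computable n (f : seq nat -> nat) : Prop :=
  exists c, forall v, size v = n -> eval0 c v (f v).

Lemma eq_computable n f g : (forall v, size v = n -> f v = g v) ->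
  computable n f -> computable n g.
Proof. by move=> fg [c cP]; exists c => v vn; rewrite -fg //; exact: cP. Qed.

Lemma computable_proj n i : computable n (fun v => nth 0 v i).
Proof. by exists (Proj i). Qed.

Lemma computable_compose n m f (g : nat -> seq nat -> nat) : computable m f ->
  (forall i, i < m -> computable n (g i)) ->
  computable n (fun v => f (mkseq (fun i => g i v) m)).
Proof.
move=> [cf cfP] cg.
have /choice[d dP] : forall i : 'I_m, exists c,
    forall v, size v = n -> eval0 c v (g i v) by move=> i; exact: cg.
exists (Comp cf d) => v vn; exists (fun i => g i v); split=> [i|].
  exact: dP.
by rewrite (map_enum_ord _ (g^~ v)); apply: cfP; rewrite size_mkseq.
Qed.

Lemma computable1 n f g : computable 1 (fun v => f (nth 0 v 0)) ->
  computable n g -> computable n (fun v => f (g v)).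
Proof.
move=> cf cg; apply: eq_computable (computable_compose (g := fun=> g) cf _) => //.
Qed.

Lemma computable2 n f g h :
  computable 2 (fun v => f (nth 0 v 0) (nth 0 v 1)) ->
  computable n g -> computable n h -> computable n (fun v => f (g v) (h v)).
Proof.
move=> cf cg ch.
apply: eq_computable
  (computable_compose (g := fun i => nth g [:: g; h] i) cf _) => //.
by case=> [|[]].
Qed.

Lemma computable_behead n f :
  computable n f -> computable n.+1 (fun v => f (behead v)).
Proof.
move=> cf.
apply: eq_computable (computable_compose (g := fun i v => nth 0 v i.+1) cf _).
  move=> [//|a v] [vn]; congr f; apply: (@eq_from_nth _ 0); rewrite size_mkseq //.
  by move=> i ilt; rewrite nth_mkseq.
by move=> i _; exact: computable_proj.
Qed.

Lemma computable_const n k : computable n (fun=> k).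
Proof.
elim: k => [|k [c cP]]; first by exists Zero.
exists (Comp Succ (fun _ : 'I_1 => c)) => v vn.
exists (fun=> k); split=> [i|]; first exact: cP.
by rewrite (map_enum_ord _ (fun=> k)).
Qed.

Lemma computable_succ n f : computable n f -> computable n (fun v => (f v).+1).
Proof. by apply: (@computable1 _ S); exists Succ => -[]. Qed.

Definition rec (a : nat) (g : nat -> nat -> nat) : nat -> nat :=
  nat_rect (fun=> nat) a g.

(** [PrimRec] recurses on the head of its argument list, so a composition first puts the bound [m v]
    there, in front of a copy of [v]. *)
Lemma computable_rec n m f (g : nat -> nat -> seq nat -> nat) :
  computable n m -> computable n f ->
  computable n.+2 (fun w => g (nth 0 w 0) (nth 0 w 1) (behead (behead w))) ->
  computable n (fun v => rec (f v) (fun i h => g i h v) (m v)).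
Proof.
move=> cm [cf cfP] [cg cgP].
have crec : computable n.+1
    (fun v => rec (f (behead v)) (fun i h => g i h (behead v)) (nth 0 v 0)).
  exists (PrimRec cf cg) => -[//|a v] /= [vn].
  exists (rec (f v) (fun i h => g i h v)); split => //; first exact: cfP.
  by move=> i _; apply: (cgP [:: i, _ & v]); rewrite /= vn.
have /(_ n)/= := computable_compose
  (g := fun i v => if i is j.+1 then nth 0 v j else m v) crec.
move=> /(_ _)/eq_computable; apply => [v vn|[|i] _ //]; last exact: computable_proj.
rewrite /mkseq /=.
have -> // : [seq (if i is j.+1 then nth 0 v j else m v) | i <- iota 1 n] = v.
apply: (@eq_from_nth _ 0); rewrite size_map size_iota // => i ilt.
by rewrite (nth_map 0) ?size_iota // nth_iota.
Qed.

Lemma computable_shift2 n i :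
  computable n.+2 (fun w => nth 0 (behead (behead w)) i).
Proof.
apply: (computable_behead (f := fun v => nth 0 (behead v) i)).
by apply: (computable_behead (f := nth 0 ^~ i)); exact: computable_proj.
Qed.

Lemma computable_rec2 n m f (g : nat -> nat -> seq nat -> nat) h :
  (forall v, size v = n -> rec (f v) (fun i r => g i r v) (m v) = h v) ->
  computable n m -> computable n f ->
  computable n.+2 (fun w => g (nth 0 w 0) (nth 0 w 1) (behead (behead w))) ->
  computable n h.
Proof.
by move=> gh cm cf cg; apply: eq_computable gh (computable_rec cm cf cg).
Qed.

Lemma computable_add n f g : computable n f -> computable n g ->
  computable n (fun v => f v + g v).
Proof.
apply: (@computable2 n addn).
apply: (@computable_rec2 2 (nth 0 ^~ 1) (nth 0 ^~ 0) (fun _ h _ => h.+1)).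
- by move=> v _ /=; elim: (nth 0 v 1) => [|k /= ->]; rewrite ?addn0 ?addnS.
- exact: computable_proj.
- exact: computable_proj.
- by apply: computable_succ; exact: computable_proj.
Qed.

Lemma computable_pred n f : computable n f -> computable n (fun v => (f v).-1).
Proof.
apply: (@computable1 n predn).
apply: (@computable_rec2 1 (nth 0 ^~ 0) (fun=> 0) (fun i _ _ => i)).
- by move=> v _; case: (nth 0 v 0).
- exact: computable_proj.
- exact: computable_const.
- exact: computable_proj.
Qed.

Lemma computable_sub n f g : computable n f -> computable n g ->
  computable n (fun v => f v - g v).
Proof.
apply: (@computable2 n subn).
apply: (@computable_rec2 2 (nth 0 ^~ 1) (nth 0 ^~ 0) (fun _ h _ => h.-1)).
- by move=> v _ /=; elim: (nth 0 v 1) => [|k /= ->]; rewrite ?subn0 ?subnS.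
- exact: computable_proj.
- exact: computable_proj.
- by apply: computable_pred; exact: computable_proj.
Qed.

Lemma computable_mul n f g : computable n f -> computable n g ->
  computable n (fun v => f v * g v).
Proof.
apply: (@computable2 n muln).
apply: (@computable_rec2 2 (nth 0 ^~ 1) (fun=> 0) (fun _ h v => h + nth 0 v 0)).
- by move=> v _; elim: (nth 0 v 1) => [|k /= ->]; rewrite ?muln0 // mulnS addnC.
- exact: computable_proj.
- exact: computable_const.
- by apply: computable_add; [exact: computable_proj|exact: computable_shift2].
Qed.

Lemma computable_exp2 n f : computable n f -> computable n (fun v => 2 ^ f v).
Proof.
apply: (@computable1 n (expn 2)).
apply: (@computable_rec2 1 (nth 0 ^~ 0) (fun=> 1) (fun _ h _ => h + h)).
- by move=> v _; elim: (nth 0 v 0) => [|k /= ->]; rewrite ?expnS ?mul2n ?addnn.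
- exact: computable_proj.
- exact: computable_const.
- by apply: computable_add; exact: computable_proj.
Qed.

Lemma computable_odd n f : computable n f -> computable n (fun v => odd (f v)).
Proof.
apply: (@computable1 n (fun k => odd k)).
apply: (@computable_rec2 1 (nth 0 ^~ 0) (fun=> 0) (fun _ h _ => 1 - h)).
- by move=> v _; elim: (nth 0 v 0) => [|k /= ->] //; case: odd.
- exact: computable_proj.
- exact: computable_const.
- by apply: computable_sub; [exact: computable_const|exact: computable_proj].
Qed.

(** The recursion is (i + 1)./2 = i - i./2. *)
Lemma computable_half n f : computable n f -> computable n (fun v => (f v)./2).
Proof.
apply: (@computable1 n half).
apply: (@computable_rec2 1 (nth 0 ^~ 0) (fun=> 0) (fun i h _ => i - h)).
- by move=> v _; elim: (nth 0 v 0) => [|k /= ->] //; rewrite uphalf_half; lia.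
- exact: computable_proj.
- exact: computable_const.
- by apply: computable_sub; exact: computable_proj.
Qed.

Lemma computable_leq n f g : computable n f -> computable n g ->
  computable n (fun v => f v <= g v).
Proof.
move=> cf cg; apply: (@eq_computable n (fun v => 1 - (f v - g v))).
  by move=> v _; rewrite /leq; case: (f v - g v).
by apply/computable_sub/computable_sub => //; exact: computable_const.
Qed.

Lemma computable_and n (f g : seq nat -> bool) :
  computable n f -> computable n g -> computable n (fun v => f v && g v).
Proof.
move=> cf cg; apply: eq_computable (computable_mul cf cg) => v _.
by rewrite mulnb.
Qed.

Lemma computable_if n (b : seq nat -> bool) f g :
  computable n b -> computable n f -> computable n g ->
  computable n (fun v => if b v then f v else g v).
Proof.
move=> cb cf cg.
apply: (@eq_computable n (fun v => b v * f v + (1 - b v) * g v)).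
  by move=> v _; case: (b v); rewrite ?mul1n ?mul0n ?addn0.
apply: computable_add; apply: computable_mul => //.
by apply: computable_sub => //; exact: computable_const.
Qed.

Lemma computable_max n f g : computable n f -> computable n g ->
  computable n (fun v => maxn (f v) (g v)).
Proof.
move=> cf cg; apply: (@eq_computable n (fun v => f v + (g v - f v))).
  by move=> v _; rewrite maxnE.
by apply/computable_add/computable_sub.
Qed.

Lemma computable_min n f g : computable n f -> computable n g ->
  computable n (fun v => minn (f v) (g v)).
Proof.
move=> cf cg; apply: (@eq_computable n (fun v => f v - (f v - g v))).
  by move=> v _; rewrite minnE.
by apply/computable_sub/computable_sub.
Qed.

Lemma computable4 n f g0 g1 g2 g3 :
  computable 4 (fun v => f (nth 0 v 0) (nth 0 v 1) (nth 0 v 2) (nth 0 v 3)) ->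
  computable n g0 -> computable n g1 -> computable n g2 -> computable n g3 ->
  computable n (fun v => f (g0 v) (g1 v) (g2 v) (g3 v)).
Proof.
move=> cf c0 c1 c2 c3.
apply: eq_computable
  (computable_compose (g := fun i => nth g0 [:: g0; g1; g2; g3] i) cf _) => //.
by case=> [|[|[|[|]]]].
Qed.

(* In bijective base 2, removing the first bit is [a |-> (a - 1) / 2]. *)
Definition code_drop (a i : nat) : nat := rec a (fun _ h => h.-1./2) i.

(** A nonempty code is 2a' + b + 1, so its predecessor has parity b. Past the end the code is 0 and
    the bit reads false, in agreement with [nth false]. *)
Definition code_nth (a i : nat) : bool := odd (code_drop a i).-1.

(** The digits of bijective base 2 are 1 and 2: bit b in position i contributes 2^i (b + 1). *)
Definition code_take (a i : nat) : nat :=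
  rec 0 (fun i h => h + 2 ^ i * (code_nth a i).+1) i.

(** Counts the nonempty suffixes; [a] rounds suffice because a string is no longer than its code. *)
Definition code_size (a : nat) : nat :=
  rec 0 (fun i h => h + (0 < code_drop a i)) a.

Definition code_rcons (a : nat) (b : bool) : nat := a + 2 ^ code_size a * b.+1.

Ltac computability_step := lazymatch goal with
  | |- computable _ (fun v => nth 0 v ?i) => exact: computable_proj
  | |- computable _ (fun v => nth 0 (behead (behead v)) ?i) =>
      exact: computable_shift2
  | |- computable _ (fun _ => ?k) => exact: computable_const
  | |- computable _ (fun v => (@?f v).+1) => apply: computable_succ
  | |- computable _ (fun v => @?f v + @?g v) => apply: computable_add
  | |- computable _ (fun v => @?f v - @?g v) => apply: computable_sub
  | |- computable _ (fun v => @?f v * @?g v) => apply: computable_mul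
  | |- computable _ (fun v => 2 ^ @?f v) => apply: computable_exp2
  | |- computable _ (fun v => (@?f v).-1) => apply: computable_pred
  | |- computable _ (fun v => (@?f v)./2) => apply: computable_half
  | |- computable _ (fun v => nat_of_bool (@?f v <= @?g v)) =>
      apply: computable_leq
  end.

Ltac computability := repeat computability_step.

Lemma computable_code_drop n f g : computable n f -> computable n g ->
  computable n (fun v => code_drop (f v) (g v)).
Proof.
apply: (@computable2 n code_drop).
apply: (@computable_rec2 2 (nth 0 ^~ 1) (nth 0 ^~ 0) (fun _ h _ => h.-1./2)) => //;
  computability.
Qed.

Lemma computable_code_nth n f g : computable n f -> computable n g ->
  computable n (fun v => code_nth (f v) (g v)).
Proof.
by move=> cf cg; apply/computable_odd/computable_pred/computable_code_drop.
Qed.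

Lemma computable_code_take n f g : computable n f -> computable n g ->
  computable n (fun v => code_take (f v) (g v)).
Proof.
apply: (@computable2 n code_take).
apply: (@computable_rec2 2 (nth 0 ^~ 1) (fun=> 0)
  (fun i h v => h + 2 ^ i * (code_nth (nth 0 v 0) i).+1)) => //; computability.
apply: computable_code_nth; computability.
Qed.

Lemma computable_code_size n f : computable n f ->
  computable n (fun v => code_size (f v)).
Proof.
apply: (@computable1 n code_size).
apply: (@computable_rec2 1 (nth 0 ^~ 0) (fun=> 0)
  (fun i h v => h + (0 < code_drop (nth 0 v 0) i))) => //; computability.
apply: computable_code_drop; computability.
Qed.

Lemma computable_code_rcons n f (b : seq nat -> bool) :
  computable n f -> computable n b ->
  computable n (fun v => code_rcons (f v) (b v)).
Proof.
move=> cf cb; apply: computable_add => //; apply: computable_mul.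
  exact/computable_exp2/computable_code_size.
exact: computable_succ.
Qed.

(** * Correctness of the operations on string codes *)

Lemma code_dropE s i : code_drop (str_code s) i = str_code (drop i s).
Proof.
elim: i => [|i IHi]; first by rewrite drop0.
rewrite /code_drop /= -/(code_drop _ i) IHi -addn1 addnC -drop_drop.
by case: (drop i s) => [|b t] //=; rewrite drop0 addnC half_bit_double.
Qed.

Lemma code_nthE s i : code_nth (str_code s) i = nth false s i.
Proof.
rewrite /code_nth code_dropE -[i in RHS]addn0 -nth_drop.
by case: (drop i s) => [|b t] //=; rewrite oddD odd_double oddb.
Qed.

Lemma str_code_rcons s b :
  str_code (rcons s b) = str_code s + 2 ^ size s * b.+1.
Proof.
elim: s => [|a s IHs] /=; first by case: b.
by rewrite IHs expnS; case: a; case: b {IHs}; lia.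
Qed.

Lemma code_takeE s i : i <= size s ->
  code_take (str_code s) i = str_code (take i s).
Proof.
elim: i => [|i IHi] ilt; first by rewrite take0.
rewrite /code_take /= -/(code_take _ i) (IHi (ltnW ilt)) code_nthE.
by rewrite (take_nth false) // str_code_rcons size_take ilt.
Qed.

Lemma size_str_code s : size s <= str_code s.
Proof. by elim: s => //= b s; lia. Qed.

Lemma str_code_gt0 s : (0 < str_code s) = (0 < size s).
Proof. by case: s. Qed.

Lemma code_sizeE s : code_size (str_code s) = size s.
Proof.
suff H n : rec 0 (fun i h => h + (0 < code_drop (str_code s) i)) n =
    minn n (size s).
  by rewrite /code_size H; exact/minn_idPr/size_str_code.
elim: n => [|n IHn] /=; first by rewrite min0n.
by rewrite IHn code_dropE str_code_gt0 size_drop; lia.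
Qed.

Lemma code_rconsE s b : code_rcons (str_code s) b = str_code (rcons s b).
Proof. by rewrite /code_rcons code_sizeE str_code_rcons. Qed.

Local Open Scope classical_set_scope.
Local Open Scope ring_scope.

(** * The measures R_c *)

Definition prob_on_strings (R : realType) (f : seq bool -> R) : Prop :=
  [/\ forall s, 0 <= f s, f [::] = 1 &
      forall s, f s = f (rcons s false) + f (rcons s true)].

Section quota.
Context (R : realType) (m n : seq bool -> R).

(* For [r = R_c(s)], this is R_c(s0): as close to [c * n(s0)] as the constraints
   R_c(s0) <= m(s0) and R_c(s1) = r - R_c(s0) <= m(s1) permit. *)
Definition quota0 (c : R) (s : seq bool) (r : R) : R :=
  Num.max (r - m (rcons s true))
    (Num.min (m (rcons s false)) (c * n (rcons s false))).

Fixpoint quota_rev (c : R) (t : seq bool) : R :=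
  if t is b :: t' then
    let r := quota_rev c t' in
    if b then r - quota0 c (rev t') r else quota0 c (rev t') r
  else c.

(* R_c; the recursion on the reversed string removes the last bit. *)
Definition quota (c : R) (s : seq bool) : R := quota_rev c (rev s).

Lemma quota_nil c : quota c [::] = c. Proof. by []. Qed.

Lemma quota_rcons c s b : quota c (rcons s b) =
  if b then quota c s - quota0 c s (quota c s) else quota0 c s (quota c s).
Proof. by rewrite /quota rev_rcons /= revK. Qed.

Lemma quota_split c s :
  quota c s = quota c (rcons s false) + quota c (rcons s true).
Proof. by rewrite !quota_rcons; ring. Qed.

Hypotheses (mP : prob_on_strings m) (nP : prob_on_strings n).

Let m_ge0 s : 0 <= m s. Proof. by case: mP. Qed.
Let n_ge0 s : 0 <= n s. Proof. by case: nP. Qed.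
Let m_nil : m [::] = 1. Proof. by case: mP. Qed.
Let n_nil : n [::] = 1. Proof. by case: nP. Qed.
Let m_split s : m s = m (rcons s false) + m (rcons s true).
Proof. by case: mP. Qed.
Let n_split s : n s = n (rcons s false) + n (rcons s true).
Proof. by case: nP. Qed.

(** With n0, n1 the values of c n at the children, the right child gets min(m1, r - min(m0, n0)). By
    induction r >= m0 + m1 or r >= n0 + n1, and in either case this is at least min(m1, n1). The
    left child stays below m0 because r <= m0 + m1. *)
Lemma quota_bounds c s : 0 <= c <= 1 ->
  Num.min (m s) (c * n s) <= quota c s <= m s.
Proof.
move=> /andP[c0 c1]; elim/last_ind: s => [|s b IHs].
  by rewrite m_nil n_nil quota_nil mulr1 ge_min lexx orbT.
rewrite quota_rcons /quota0.
move: IHs; set r := quota c s.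
have := m_ge0 (rcons s false); have := m_ge0 (rcons s true).
have := mulr_ge0 c0 (n_ge0 (rcons s false)).
have := mulr_ge0 c0 (n_ge0 (rcons s true)).
rewrite (m_split s) (n_split s) mulrDr.
set m0 := m (rcons s false); set m1 := m (rcons s true).
set n0 := c * n (rcons s false); set n1 := c * n (rcons s true).
move=> n1_ge0 n0_ge0 m1_ge0 m0_ge0.
case: b; rewrite -/m0 -/m1 -/n0 -/n1;
  have [e1|e1] := leP (m0 + m1) (n0 + n1); have [e2|e2] := leP m0 n0;
  have [e3|e3] := leP m1 n1; have [e4|e4] := leP (r - m1) m0;
  have [e5|e5] := leP (r - m1) n0; lra.
Qed.

(** The induction step of [quota_increment], with primes for the larger parameter. An unsaturated
    left child grows by n0' - n0, or else by r' - r, which is no less since n1 <= n1'. An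
    unsaturated right child gets r' - min(m0, n0'), where the min has grown by at most n0' - n0. *)
Lemma quota0_increment (r r' m0 m1 n0 n1 n0' n1' : R) :
  n0 <= n0' -> n1 <= n1' ->
  r <= m0 + m1 ->
  r' <= m0 + m1 ->
  r' = m0 + m1 \/ (n0' + n1') - (n0 + n1) <= r' - r ->
  let r0 := Num.max (r - m1) (Num.min m0 n0) in
  let r0' := Num.max (r' - m1) (Num.min m0 n0') in
  (r0' = m0 \/ n0' - n0 <= r0' - r0) /\
  (r' - r0' = m1 \/ n1' - n1 <= (r' - r0') - (r - r0)).
Proof.
move=> n00' n11' br br' H /=.
have [e2|e2] := leP m0 n0'; have [e1|e1] := leP (r' - m1);
  have [e3|e3] := leP m0 n0; have [e4|e4] := leP (r - m1);
  try (by exfalso; lra);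
  split; try (by left; lra); case: H => H; try (by left; lra);
  try (by right; lra); exfalso; lra.
Qed.

(* Monotonicity in [c] alone is not inductive; this strengthening is. *)
Lemma quota_increment c c' s : 0 <= c -> c <= c' -> c' <= 1 ->
  quota c' s = m s \/ (c' - c) * n s <= quota c' s - quota c s.
Proof.
move=> c0 cc' c1.
have b0 u : Num.min (m u) (c * n u) <= quota c u <= m u.
  by apply: quota_bounds; lra.
have b1 u : Num.min (m u) (c' * n u) <= quota c' u <= m u.
  by apply: quota_bounds; lra.
elim/last_ind: s => [|s b IHs]; first by right; rewrite !quota_nil n_nil mulr1.
rewrite !quota_rcons /quota0; move: IHs (b0 s) (b1 s).
have -> : (c' - c) * n s = (c' * n (rcons s false) + c' * n (rcons s true)) -
    (c * n (rcons s false) + c * n (rcons s true)).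
  by rewrite n_split; ring.
rewrite (m_split s) => IHs /andP[_ b0s] /andP[_ b1s].
have [H0 H1] := quota0_increment (ler_wpM2r (n_ge0 _) cc')
  (ler_wpM2r (n_ge0 _) cc') b0s b1s IHs.
by rewrite mulrBl; case: b.
Qed.

Lemma quota_mono c c' s : 0 <= c -> c <= c' -> c' <= 1 ->
  quota c s <= quota c' s.
Proof.
move=> c0 cc' c1; have [->|] := quota_increment s c0 cc' c1.
  by have /andP[] := @quota_bounds c s ltac:(lra).
by have := mulr_ge0 (_ : 0 <= c' - c) (n_ge0 s); lra.
Qed.

End quota.

(** * The intervals I_k(s) *)

Section intervals.
Context (R : realType) (m n : seq bool -> R).
Notation quota := (quota m n).

(* [offset c s] is [c] plus the R_c-mass to the left of [s]; the summand [c] puts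
   I_k([::]) at ]2^-(k+1), 2^-k[. *)
Fixpoint offset_rev (c : R) (t : seq bool) : R :=
  if t is b :: t' then
    offset_rev c t' + (if b then quota c (rev t') - quota c (rev t) else 0)
  else c.

Definition offset (c : R) (s : seq bool) : R := offset_rev c (rev s).

Lemma offset_rcons c s b : offset c (rcons s b) =
  offset c s + (if b then quota c s - quota c (rcons s b) else 0).
Proof. by rewrite /offset rev_rcons /= rev_cons revK. Qed.

Definition level (k : nat) : R := (2 ^+ k)^-1.

Definition itv_lo (k : nat) (s : seq bool) : R :=
  offset (level k) s - offset (level k.+1) s.

Definition itv_hi (k : nat) (s : seq bool) : R :=
  (offset (level k) s + quota (level k) s) -
  (offset (level k.+1) s + quota (level k.+1) s).

Lemma level_gt0 k : 0 < level k.
Proof. by rewrite invr_gt0 exprn_gt0. Qed.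

Lemma levelS k : level k = level k.+1 + level k.+1.
Proof. by rewrite /level exprS invfM; lra. Qed.

Lemma level_le1 k : level k <= 1.
Proof. by rewrite invf_le1 ?exprn_gt0 // exprn_ege1 // ler1n. Qed.

Lemma itv_lo_nil k : itv_lo k [::] = level k.+1.
Proof. by rewrite /itv_lo /offset /= [level k]levelS addrK. Qed.

Lemma itv_hi_nil k : itv_hi k [::] = level k.
Proof. by rewrite /itv_hi /offset /= !quota_nil levelS; ring. Qed.

Lemma itv_lo0 k s : itv_lo k (rcons s false) = itv_lo k s.
Proof. by rewrite /itv_lo !offset_rcons !addr0. Qed.

Lemma itv_hi1 k s : itv_hi k (rcons s true) = itv_hi k s.
Proof. by rewrite /itv_hi !offset_rcons; ring. Qed.

Lemma itv_hi0 k s : itv_hi k (rcons s false) = itv_lo k (rcons s true).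
Proof.
rewrite /itv_hi /itv_lo !offset_rcons.
by rewrite (quota_split _ _ _ s) (quota_split _ _ (level k.+1) s); ring.
Qed.

Lemma itv_length k s :
  itv_hi k s - itv_lo k s = quota (level k) s - quota (level k.+1) s.
Proof. by rewrite /itv_hi /itv_lo; ring. Qed.

Hypotheses (mP : prob_on_strings m) (nP : prob_on_strings n).

Lemma itv_lo_le_hi k s : itv_lo k s <= itv_hi k s.
Proof.
rewrite -subr_ge0 itv_length subr_ge0 quota_mono //.
- exact/ltW/level_gt0.
- by rewrite [leRHS]levelS lerDl ltW ?level_gt0.
- exact: level_le1.
Qed.

Lemma itv_rcons k s b :
  itv_lo k s <= itv_lo k (rcons s b) /\ itv_hi k (rcons s b) <= itv_hi k s.
Proof.
have := itv_lo_le_hi k (rcons s false); have := itv_lo_le_hi k (rcons s true).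
by case: b; rewrite ?itv_lo0 ?itv_hi1 ?itv_hi0 ?lexx; lra.
Qed.

Lemma itv_prefix k s s' : prefix s s' ->
  itv_lo k s <= itv_lo k s' /\ itv_hi k s' <= itv_hi k s.
Proof.
move=> /prefixP[t ->]; elim/last_ind: t => [|t b [IHlo IHhi]].
  by rewrite cats0.
rewrite -rcons_cat; have [lo hi] := itv_rcons k (s ++ t) b.
by split; [exact: le_trans IHlo lo|exact: le_trans hi IHhi].
Qed.

Lemma incomparable_split (s t : seq bool) : ~~ prefix s t -> ~~ prefix t s ->
  exists u b, prefix (rcons u b) s /\ prefix (rcons u (~~ b)) t.
Proof.
elim: s t => [|a s IHs] [|b t]; rewrite ?prefix0s //.
rewrite !prefix_cons [b == a]eq_sym; case: eqP => [<-|/eqP ab].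
  move=> /IHs/[apply] -[u [c [us ut]]]; exists (a :: u), c.
  by rewrite !rcons_cons !prefix_cons eqxx.
move=> _ _; exists [::], a; rewrite !prefix_cons !prefix0s eqxx; split => //.
by rewrite andbT; case: a b ab => -[].
Qed.

(** Incomparable strings extend two siblings, whose intervals share only an endpoint; the strict
    inequalities for [s] exclude it. *)
Lemma itv_incomparable k s t (r : R) : ~~ prefix s t -> ~~ prefix t s ->
  itv_lo k s < r < itv_hi k s -> itv_lo k t <= r <= itv_hi k t -> False.
Proof.
move=> /incomparable_split/[apply] -[u [b [/(itv_prefix k)[s1 s2]]]].
move=> /(itv_prefix k)[t1 t2].
have := itv_hi0 k u; case: b s1 s2 t1 t2 => /=; lra.
Qed.

(** For r = m(s), the constraint that the right child gets at most m(s1) already forces m(s0) on the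
    left child. *)
Lemma quota_level0 s : quota (level 0) s = m s.
Proof.
elim/last_ind: s => [|s b IHs].
  by rewrite quota_nil /level expr0 invr1; case: mP.
case: (mP) => _ _ /(_ s) ms; rewrite quota_rcons /quota0 IHs ms addrK.
by rewrite (max_idPl _) ?ge_min ?lexx //; case: b; rewrite // addrAC subrr add0r.
Qed.

Lemma quota_ge0 c s : 0 <= c <= 1 -> 0 <= quota c s.
Proof.
move=> c01; have /andP[+ _] := quota_bounds mP nP s c01; apply: le_trans.
case: mP nP => m0 _ _ [n0 _ _]; rewrite le_min m0 mulr_ge0 //.
by case/andP: c01.
Qed.

Lemma quota_le c s : 0 <= c <= 1 -> quota c s <= c.
Proof.
move=> c01; elim/last_ind: s => [|s b IHs]; first by rewrite quota_nil.
apply: le_trans IHs; rewrite [leRHS]quota_split.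
by case: b; rewrite ?lerDl ?lerDr quota_ge0.
Qed.

(** A telescoping sum starting from R_1 = m; the remainder is at most 2^-K by [quota_le]. *)
Lemma itv_sum K s :
  \sum_(k < K) (itv_hi k s - itv_lo k s) = m s - quota (level K) s.
Proof.
elim: K => [|K IHK]; first by rewrite big_ord0 quota_level0 subrr.
by rewrite big_ord_recr /= IHK itv_length; ring.
Qed.

Lemma itv_bounds k s : level k.+1 <= itv_lo k s /\ itv_hi k s <= level k.
Proof.
have [] := @itv_prefix k [::] s (prefix0s s).
by rewrite itv_lo_nil itv_hi_nil.
Qed.

Lemma itv_empty k s : m s <= level k.+1 * n s -> itv_hi k s = itv_lo k s.
Proof.
move=> mn; apply/eqP; rewrite -subr_eq0 itv_length subr_eq0 eq_le; apply/andP.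
have l01 j : 0 <= level j <= 1 by rewrite ltW ?level_gt0 ?level_le1.
split; last by rewrite -subr_ge0 -itv_length subr_ge0 itv_lo_le_hi.
have /andP[_ h0] := quota_bounds mP nP s (l01 k).
have /andP[+ _] := quota_bounds mP nP s (l01 k.+1).
by rewrite (min_idPl mn) => /(le_trans h0).
Qed.

End intervals.

(** * The machine *)

Section string_val.
Context (R : realType).
Notation val := (string_val R).

Lemma string_val_rcons s b :
  val (rcons s b) = val s + b%:R * level R (size s).+1.
Proof.
elim: s => [|a s IHs] /=; first by rewrite /level expr1; ring.
by rewrite IHs /level !exprS !invfM; ring.
Qed.

Lemma level_le_string_val s i : nth false s i -> level R i.+1 <= val s.
Proof.
elim: s i => [|b s IHs] [|i] //=.
  have [v0 _] := string_val_itv R s.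
  by move=> ->; rewrite /level expr1 /=; lra.
by move=> /IHs; have := levelS R i.+1; have := ler0n R b; lra.
Qed.

Lemma string_val_nseq k : val (nseq k false) = 0.
Proof. by elim: k => //= k ->; rewrite addr0 mul0r. Qed.

Lemma string_val_rcons_itv s b : val s <= val (rcons s b) /\
  val (rcons s b) + level R (size s).+1 <= val s + level R (size s).
Proof.
have := level_gt0 R (size s).+1; have := levelS R (size s).
by rewrite string_val_rcons; case: b => /=; lra.
Qed.

End string_val.

Lemma find_rcons_lt (s : seq bool) b :
  (find id s < size s)%N -> find id (rcons s b) = find id s.
Proof. by rewrite -has_find -cats1 find_cat => ->. Qed.

Lemma restrS (z : cantor) j : restr z j.+1 = rcons (restr z j) (z j).
Proof. by rewrite /restr /mkseq -addn1 iotaD map_cat cats1. Qed.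

Lemma size_restr (z : cantor) j : size (restr z j) = j.
Proof. exact: size_mkseq. Qed.

Lemma prefix_restr (z : cantor) i j :
  (i <= j)%N -> prefix (restr z i) (restr z j).
Proof.
elim: j => [|j IHj]; first by case: i.
rewrite leq_eqVlt => /orP[/eqP -> //|]; first exact: prefix_refl.
by rewrite restrS => /IHj/prefix_trans; apply; exact: prefix_rcons.
Qed.

Lemma prefix_size_eq (s t : seq bool) :
  prefix s t -> (size t <= size s)%N -> s = t.
Proof. by rewrite prefixE => /eqP + st; rewrite take_oversize. Qed.

Section machine.
Context (T : seq bool -> seq bool -> bool).

(** Appending at most one bit per input bit makes the machine total and monotone by construction.
    The delay is harmless, since a test that succeeds at an interior point succeeds on all
    sufficiently long prefixes. *)
Fixpoint out_rev (t : seq bool) : seq bool :=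
  if t is _ :: t' then
    let u := out_rev t' in
    if T (rev t) (rcons u false) then rcons u false
    else if T (rev t) (rcons u true) then rcons u true else u
  else [::].

Definition out (s : seq bool) : seq bool := out_rev (rev s).

Lemma out_rcons s b : out (rcons s b) =
  if T (rcons s b) (rcons (out s) false) then rcons (out s) false
  else if T (rcons s b) (rcons (out s) true) then rcons (out s) true
  else out s.
Proof. by rewrite /out rev_rcons /= rev_cons revK. Qed.

Lemma out_prefix s s' : prefix s s' -> prefix (out s) (out s').
Proof.
move=> /prefixP[t ->]; elim/last_ind: t => [|t b IHt].
  by rewrite cats0 prefix_refl.
apply: prefix_trans IHt _; rewrite -rcons_cat out_rcons.
by do 2?[case: ifP => _; first exact: prefix_rcons]; exact: prefix_refl.
Qed.

Context (R : realType) (m n : seq bool -> R).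
Hypotheses (mP : prob_on_strings m) (nP : prob_on_strings n).
Notation lo := (itv_lo m n).
Notation hi := (itv_hi m n).
Notation val := (string_val R).

(* A string with exactly [k] leading zeros, then a one, consists of expansions of
   reals in [2^-(k+1), 2^-k]; hence [find id s] selects the level. *)
Definition certified (s u : seq bool) : Prop :=
  [/\ (find id s < size s)%N, lo (find id s) u <= val s &
      val s + level R (size s) <= hi (find id s) u].

Hypothesis T_sound : forall s u, T s u -> certified s u.
Hypothesis T_complete : forall k u r, lo k u < r < hi k u ->
  exists J, forall s, (J <= size s)%N -> (find id s < size s)%N ->
  find id s = k -> val s <= r < val s + level R (size s) -> T s u.

(** An old output stays certified: a further input bit shrinks the dyadic interval and does not move
    the first one. The empty output may be uncertified, as no one need have been read. *)
Lemma out_certified s : out s = [::] \/ certified s (out s).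
Proof.
elim/last_ind: s => [|s b IHs]; first by left.
rewrite out_rcons; case: ifP => [/T_sound|_]; first by right.
case: ifP => [/T_sound|_]; first by right.
case: IHs => [->|[ks slo shi]]; [by left|right; rewrite /certified].
rewrite find_rcons_lt // size_rcons ltnS ltnW //.
by have [? ?] := string_val_rcons_itv R s b; split => //; lra.
Qed.

(** The half-open intervals select, for a dyadic [r], the expansion that ends in zeros, as
    [binary_digits] does. *)
Definition real_point (z : cantor) (r : R) : Prop :=
  forall j, val (restr z j) <= r < val (restr z j) + level R j.

Lemma find_real_point z r k : real_point z r -> level R k.+1 < r < level R k ->
  forall j, (k < j)%N -> find id (restr z j) = k.
Proof.
move=> zr /andP[r1 r2].
have zi i : (i < k)%N -> z i = false.
  move=> ik; apply/negP => zi.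
  have /andP[+ _] := zr i.+1.
  have : level R i.+1 <= val (restr z i.+1).
    by apply: level_le_string_val; rewrite nth_mkseq.
  suff : level R k <= level R i.+1 by lra.
  by rewrite /level lef_pV2 ?posrE ?exprn_gt0 // ler_eXn2l // ltr1n.
have zk : restr z k = nseq k false.
  apply: (@eq_from_nth _ false); rewrite size_restr ?size_nseq // => i ik.
  by rewrite nth_mkseq // nth_nseq ik zi.
have zkt : z k = true.
  apply/negPn/negP => /negPf zkf; have /andP[_] := zr k.+1.
  by rewrite restrS string_val_rcons zkf zk string_val_nseq mul0r; lra.
move=> j; elim: j => // j IHj; rewrite ltnS leq_eqVlt => /orP[/eqP <-|kj].
  rewrite restrS zk zkt -cats1 find_cat has_nseq andbF /= size_nseq addn0 //.
by rewrite restrS find_rcons_lt ?IHj // size_restr.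
Qed.

(** A certified output has [r] in its closed interval, which the interior of the interval of an
    incomparable [u] does not meet. *)
Lemma out_comparable z r k u j : real_point z r -> lo k u < r < hi k u ->
  prefix u (out (restr z j)) || prefix (out (restr z j)) u.
Proof.
move=> zr ur; apply/negPn/negP; rewrite negb_or => /andP[n1 n2].
have [e0|outP] := out_certified (restr z j).
  by move: n2; rewrite e0 prefix0s.
case: outP.
have [l1 l2] := itv_bounds mP nP k u.
rewrite size_restr => kj; have /andP[z1 z2] := zr j.
have -> : find id (restr z j) = k.
  have fk := @find_real_point z r k zr ltac:(lra).
  (* If j <= k, the one seen among the first j digits would keep [find] below j at length k + 1,
     where it equals k. *)
  case: (ltnP k j) => [|jk]; first exact: fk.
  have kS := fk k.+1 (leqnn _).
  have /prefixP[t zt] := prefix_restr z (leqW jk).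
  move: kS; rewrite zt find_cat has_find size_restr kj => kk.
  by move: kj; rewrite kk ltnNge jk.
move=> o1 o2; apply: (itv_incomparable mP nP n1 n2 ur); lra.
Qed.

Lemma out_reaches z r k u : real_point z r -> lo k u < r < hi k u ->
  exists j, prefix u (out (restr z j)).
Proof.
move=> zr; elim/last_ind: u => [|u b IHu] ur.
  by exists 0%N; rewrite prefix0s.
have [b1 b2] := itv_rcons mP nP k u b.
have [j uj] := IHu ltac:(lra).
have [J TJ] := T_complete ur.
have [l1 l2] := itv_bounds mP nP k u.
(* At length q + 1, [u] has already been output (j), the test accepts [rcons u b] (J), and the first
   one has been read (k). *)
pose q := maxn (maxn j J) k; exists q.+1.
have /orP[//|] := out_comparable q.+1 zr ur.
have qq : prefix (out (restr z j)) (out (restr z q)).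
  by apply/out_prefix/prefix_restr; rewrite /q; lia.
have uq := prefix_trans uj qq.
have TT : T (restr z q.+1) (rcons u b).
  have kE : find id (restr z q.+1) = k.
    by apply: (find_real_point zr); [lra|rewrite /q; lia].
  apply: TJ => //; rewrite ?kE size_restr; try (rewrite /q; lia).
  exact: zr.
move=> ob; suff uo : (size u < size (out (restr z q.+1)))%N.
  by rewrite (prefix_size_eq ob) ?prefix_refl // size_rcons.
(* If the output at q is still [u], the next step appends some bit. Only the length matters here:
   comparability with [rcons u b] determines which bit it is. *)
have [ltuo|leou] := ltnP (size u) (size (out (restr z q))).
  apply: leq_trans ltuo _; apply: size_prefix.
  exact/out_prefix/prefix_restr.
move: TT; rewrite restrS out_rcons -(prefix_size_eq uq leou).
by case: b {ur b1 b2 TJ ob} => ->; [case: ifP|]; rewrite size_rcons.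
Qed.

End machine.

(** * Measures on Cantor space *)

Lemma measurable_coordinate i : measurable_fun setT (fun z : cantor => z i).
Proof.
apply: (@measurable_fun_bool _ _ _ _ true); rewrite setTI.
apply: sub_sigma_algebra.
suff : @open cantor_space ((fun z : cantor_space => z i) @^-1` [set true]) by [].
by apply: open_comp; [move=> + _; exact: proj_continuous|exact: discrete_open].
Qed.

Lemma measurable_cyl s : measurable (cyl s).
Proof.
exact: (@measurable_preimage_cyl _ cantor id s (measurable_coordinate)).
Qed.

Lemma cyl_prefix (z : cantor) s : cyl s z <-> exists j, prefix s (restr z j).
Proof.
split => [<-|[j]]; first by exists (size s); exact: prefix_refl.
move=> sz; have ssj := size_prefix sz; rewrite size_restr in ssj.
have := prefix_restr z ssj; rewrite !prefixE size_restr in sz *.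
by rewrite /cyl/= => /eqP <-; exact/eqP.
Qed.

Lemma cyl_cat s t : cyl (s ++ t) `<=` cyl s.
Proof.
move=> z /cyl_prefix[j stz]; apply/cyl_prefix; exists j.
exact: prefix_trans (prefix_prefix _ _) stz.
Qed.

Lemma cyl_split s : cyl s = cyl (rcons s false) `|` cyl (rcons s true).
Proof.
apply/seteqP; split => [z sz|z]; last first.
  by case; rewrite -cats1; exact: cyl_cat.
have : cyl (rcons s (z (size s))) z by rewrite /cyl /= size_rcons restrS sz.
by case: (z (size s)); [right|left].
Qed.

Lemma cyl_inj s t z : size s = size t -> cyl s z -> cyl t z -> s = t.
Proof. by rewrite /cyl /= => -> -> ->. Qed.

Lemma fine_probability_prob_on_strings (R : realType)
    (P : probability cantor R) :
  prob_on_strings (fun s => fine (P (cyl s))).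
Proof.
split => [s||s]; first exact: fine_ge0.
  suff -> : cyl [::] = setT by rewrite probability_setT.
  by apply/seteqP; split.
rewrite -fineD ?fin_num_measure //; try exact: measurable_cyl.
rewrite [in LHS]cyl_split measureU //; try exact: measurable_cyl.
apply/seteqP; split => // z [] sf st.
by have := cyl_inj _ sf st; rewrite !size_rcons => /(_ erefl)/rcons_inj[].
Qed.

Lemma measurable_cantor_cyl :
  (@measurable _ cantor) = <<s [set A | A = set0 \/ exists s, A = cyl s] >>.
Proof.
apply/seteqP; split => A.
  apply: smallest_sub; first exact: smallest_sigma_algebra.
  move=> U oU.
  have -> : U = \bigcup_s (if `[< cyl s `<=` U >] then cyl s else set0).
    apply/seteqP; split => [x /= Ux|x [s _]].
      have [k kU] := open_cyl oU Ux; exists (restr x k) => //.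
      by rewrite asboolT //= /cyl /= size_restr.
    by case: asboolP => // sU /sU.
  apply: (@countable_bigcupT_measurable _
    (g_sigma_algebraType [set A | A = set0 \/ exists s, A = cyl s])).
    exact: countableP.
  move=> s; apply: sub_sigma_algebra.
  by case: ifP => _; [right; exists s|left].
apply: smallest_sub; first exact: sigma_algebra_measurable.
by move=> _ [->|[s ->]]; [exact: measurable0|exact: measurable_cyl].
Qed.

(** Two cylinders are nested or disjoint, so adding the empty set gives a pi-system, as the
    uniqueness of measures requires. *)
Lemma cyl_setI_closed : setI_closed [set A | A = set0 \/ exists s, A = cyl s].
Proof.
move=> _ _ [->|[s ->]] [->|[t ->]]; rewrite ?setI0 ?set0I; try by left.
wlog st : s t / (size s <= size t)%N.
  by case: (leqP (size s) (size t)) => [|/ltnW] st /(_ _ _ st); rewrite // setIC.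
have [/prefixP[u ->]|nst] := boolP (prefix s t).
  by right; exists (s ++ u); apply/setIidPr/cyl_cat.
left; apply/seteqP; split => // z []; rewrite /cyl /= => sz tz.
by move: nst; rewrite -sz -tz prefix_restr.
Qed.

Lemma probability_cyl_unique (R : realType) (P Q : probability cantor R) :
  (forall s, P (cyl s) = Q (cyl s)) -> forall A, measurable A -> P A = Q A.
Proof.
move=> PQ A mA; apply: (@measure_unique _ _ _ _ (fun=> cyl [::])
  measurable_cantor_cyl cyl_setI_closed _ _ P Q _ _ A) => //.
- by right; exists [::].
- by apply/seteqP; split => // z _; exists 0%N.
- by move=> _ [->|[s ->]]; [rewrite !measure0|exact: PQ].
- by move=> _; rewrite -ge0_fin_numE // fin_num_measure //; exact: measurable_cyl.
Qed.

Lemma uniform_prob01_ooitv (R : realType) (a b : R) :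
  0 <= a -> a <= b -> b <= 1 ->
  uniform_prob (@ltr01 R) `]a, b[ = (b - a)%:E.
Proof.
move=> a0 ab b1; rewrite /uniform_prob.
rewrite (eq_integral (fun=> 1%E)); last first.
  move=> x; rewrite inE /= in_itv /= => /andP[ax xb].
  rewrite /uniform_pdf (le_trans a0 (ltW ax)) (ltW (lt_le_trans xb b1)).
  by rewrite subr0 invr1.
rewrite integral_cst //= mul1e lebesgue_measure_itv /= lte_fin.
by case: ltP => // ba; rewrite (@le_anti _ _ a b) ?ab ?subrr // ab.
Qed.

Lemma real_point_binary_digits (R : realType) (r : R) : 0 <= r < 1 ->
  real_point (binary_digits r) r.
Proof.
move=> r01 j.
have := (binary_digits_cyl (restr (binary_digits r) j) r01).1.
by rewrite size_restr; apply; rewrite /cyl /= size_restr.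
Qed.

Lemma level_small (R : realType) (e : R) : 0 < e -> exists k, level R k < e.
Proof.
move=> e0; exists (Num.trunc e^-1).+1; rewrite /level invf_plt ?posrE ?exprn_gt0 //.
apply: lt_trans (truncnS_gt _) _; rewrite -natrX ltr_nat.
exact: ltn_expl.
Qed.

Lemma probability_fine_add d (T : measurableType d) (R : realType)
    (P : probability T R) (A B C : set T) :
  measurable A -> measurable B -> measurable C -> A `<=` C -> B `<=` C ->
  A `&` B = set0 -> fine (P A) + fine (P B) <= fine (P C).
Proof.
move=> mA mB mC AC BC AB.
rewrite -fineD ?fin_num_measure // -measureU // fine_le ?fin_num_measure //.
- exact: measurableU.
- apply: le_measure; rewrite ?inE //; first exact: measurableU.
  by move=> x [/AC|/BC].
Qed.

Section reach.
Context (T : seq bool -> seq bool -> bool).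

(** Inputs with finite output are included. This makes the set open, and its measure can be found
    before the domain is known to have full measure. *)
Definition reach (s : seq bool) : set cantor :=
  [set z | exists j, prefix s (out T (restr z j))].

Lemma measurable_reach s : measurable (reach s).
Proof.
have -> : reach s = \bigcup_t (if prefix s (out T t) then cyl t else set0).
  apply/seteqP; split => [z [j sj]|z [t _]].
    by exists (restr z j) => //; rewrite sj /cyl /= size_restr.
  by case: ifP => // st zt; exists (size t); rewrite zt.
apply: countable_bigcupT_measurable => [|t]; first exact: countableP.
by case: ifP => // _; exact: measurable_cyl.
Qed.

Lemma reach_nil : reach [::] = setT.
Proof. by apply/seteqP; split => // z _; exists 0%N; rewrite prefix0s. Qed.

Lemma reach_rcons s b : reach (rcons s b) `<=` reach s.
Proof. by move=> z [j sj]; exists j; apply: prefix_trans (prefix_rcons _ _) sj. Qed.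

Lemma reach_inj s t z : size s = size t -> reach s z -> reach t z -> s = t.
Proof.
move=> st; suff H i j : (i <= j)%N -> forall u v, size u = size v ->
    prefix u (out T (restr z i)) -> prefix v (out T (restr z j)) -> u = v.
  move=> [i si] [j tj]; case: (leqP i j) => [ij|/ltnW ji]; first exact: (H i j).
  by apply/esym/(H j i).
move=> ij u v uv ui vj.
have := prefix_trans ui (out_prefix T (prefix_restr z ij)).
by move: vj; rewrite !prefixE uv => /eqP ev /eqP eu; exact: etrans (esym eu) ev.
Qed.

Lemma reach_disj s : reach (rcons s false) `&` reach (rcons s true) = set0.
Proof.
apply/seteqP; split => // z [] sf st.
by have := reach_inj _ sf st; rewrite !size_rcons => /(_ erefl)/rcons_inj[].
Qed.

End reach.

Section machine_map.
Context (R : realType) (mu : probability cantor R) (n : seq bool -> R).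
Hypothesis nP : prob_on_strings n.
Let m s : R := fine (mu (cyl s)).
Let mP : prob_on_strings m := fine_probability_prob_on_strings mu.
Notation lo := (itv_lo m n).
Notation hi := (itv_hi m n).
Notation val := (string_val R).

Context (T : seq bool -> seq bool -> bool).
Hypothesis T_sound : forall s u, T s u -> certified m n s u.
Hypothesis T_complete : forall k u r, lo k u < r < hi k u ->
  exists J, forall s, (J <= size s)%N -> (find id s < size s)%N ->
  find id s = k -> val s <= r < val s + level R (size s) -> T s u.

Notation reach := (reach T).

(** The intervals I_k(s) for k < K are disjoint, have total length at least m(s) - 2^-K, and the
    expansions of their interior points all reach [s]. *)
Lemma reach_ge s : ((m s)%:E <= fair_coin R (reach s))%E.
Proof.
apply/lee_addgt0Pr => e e0.
have [K Ke] := level_small e0.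
pose F k := `]lo k s, hi k s[%classic : set (measurableTypeR R).
have l01 k : 0 <= level R k <= 1 by rewrite ltW ?level_gt0 ?level_le1.
have mF k : measurable (F k) by exact: measurable_itv.
have lo_hi k : 0 <= lo k s <= hi k s /\ hi k s <= 1.
  have [h1 h2] := itv_bounds mP nP k s.
  have := itv_lo_le_hi mP nP k s; have := l01 k; have := l01 k.+1; lra.
have tF : trivIset setT F.
  have mono i j : (i < j)%N -> level R j <= level R i.+1.
    move=> ij; rewrite /level lef_pV2 ?posrE ?exprn_gt0 // ler_eXn2l // ltr1n //.
  apply/trivIsetP => i j _ _; wlog ij : i j / (i < j)%N.
    move=> H ij; have := ij; rewrite neq_ltn => /orP[ltij|ltji]; first exact: H.
    by rewrite setIC; apply: H; rewrite // eq_sym.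
  move=> _; apply/seteqP; split => // r [].
  rewrite /F /= !in_itv /= => /andP[i1 _] /andP[_ j2].
  have [b1 _] := itv_bounds mP nP i s; have [_ b2] := itv_bounds mP nP j s.
  by have := mono _ _ ij; lra.
pose U := \big[setU/set0]_(k < K) F k.
have PU : uniform_prob (@ltr01 R) U = (m s - quota m n (level R K) s)%:E.
  rewrite (measure_bigsetU _ mF tF) -(itv_sum n mP) -sumEFin.
  apply: eq_bigr => k _.
  by have [/andP[h1 h2] h3] := lo_hi k; exact: uniform_prob01_ooitv.
have UW : U `<=` (binary_digits (R := R)) @^-1` (reach s).
  move=> r; rewrite /U -bigcup_mkord => -[k _]; rewrite /F /= in_itv /= => kr.
  have [/andP[h1 h2] h3] := lo_hi k.
  apply: (out_reaches mP nP T_sound T_complete _ kr).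
  by apply: real_point_binary_digits; lra.
have : (uniform_prob (@ltr01 R) U <= fair_coin R (reach s))%E.
  apply: le_measure => //; rewrite inE; first exact: bigsetU_measurable.
  rewrite -[X in measurable X]setTI.
  by apply: measurable_binary_digits => //; exact: measurable_reach.
move=> /(leeD2r e%:E); apply: le_trans; rewrite PU -EFinD lee_fin.
by have := quota_le mP nP s (l01 K); lra.
Qed.

(* The lower bounds [reach_ge] of two siblings add up to the mass of their
   parent, so they are attained. *)
Lemma reach_measure s : fair_coin R (reach s) = (m s)%:E.
Proof.
have fin u : fair_coin R (reach u) \is a fin_num.
  by rewrite fin_num_measure //; exact: measurable_reach.
have ge u : m u <= fine (fair_coin R (reach u)).
  by rewrite -lee_fin (fineK (fin u)) reach_ge.
rewrite -(fineK (fin s)); congr (_%:E).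
elim/last_ind: s => [|s b IHs].
  by rewrite reach_nil probability_setT /=; case: mP => _ ->.
have := probability_fine_add (fair_coin R) (measurable_reach T (rcons s false))
  (measurable_reach T (rcons s true)) (measurable_reach T s) (@reach_rcons T s false)
  (@reach_rcons T s true) (reach_disj T s).
have [_ _ /(_ s)] := mP; have := ge (rcons s false); have := ge (rcons s true).
by case: b; lra.
Qed.

End machine_map.

(** * The induced map *)

Lemma probability_setD_null d (T : measurableType d) (R : realType)
    (P : probability T R) (A B C : set T) :
  measurable A -> measurable B -> measurable C -> A `<=` C -> B `<=` C ->
  A `&` B = set0 -> P C = (P A + P B)%E -> P (C `\` (A `|` B)) = 0%E.
Proof.
move=> mA mB mC AC BC AB PC; have mAB := measurableU _ _ mA mB.
rewrite measureD //; last by rewrite -ge0_fin_numE // fin_num_measure.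
rewrite (setIidr _); last by move=> x [/AC|/BC].
by rewrite measureU // [X in (_ - X)%E](esym PC) subee // fin_num_measure.
Qed.

Lemma cylE s z : cyl s z = (restr z (size s) = s). Proof. by []. Qed.

Section limit_map.
Context (R : realType) (P : probability cantor R) (m : seq bool -> R).
Context (T : seq bool -> seq bool -> bool).
Hypothesis mP : prob_on_strings m.
Hypothesis P_reach : forall s, P (reach T s) = (m s)%:E.
Notation reach := (reach T).

Definition limit_domain : set cantor :=
  [set z | forall k, exists2 s, size s = k & reach s z].

Lemma limit_domainP z : limit_domain z <->
  forall k, exists j, (k <= size (out T (restr z j)))%N.
Proof.
split => Dz k; have [] := Dz k.
  by move=> s <- [j /size_prefix sj]; exists j.
move=> j kj; exists (take k (out T (restr z j))); first exact: size_takel.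
by exists j; rewrite -{2}(cat_take_drop k (out T (restr z j))) prefix_prefix.
Qed.

Lemma measurable_limit_domain : measurable limit_domain.
Proof.
have -> : limit_domain =
    \bigcap_k \bigcup_s (if size s == k then reach s else set0).
  apply/seteqP; split => [z Dz k _|z Dz k].
    by have [s sk zs] := Dz k; exists s => //; rewrite sk eqxx.
  by have [s _] := Dz k I; case: eqP => // sk zs; exists s.
apply: bigcapT_measurable => k.
apply: countable_bigcupT_measurable => [|s]; first exact: countableP.
by case: ifP => // _; exact: measurable_reach.
Qed.

(** Outside the domain the output is stuck at some [s]: the input reaches [s] but neither child. For
    each of the countably many [s] this set is null, because [m] is additive. *)
Lemma limit_domainC_null : P (~` limit_domain) = 0%E.
Proof.
pose N s := reach s `\` (reach (rcons s false) `|` reach (rcons s true)).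
have N0 s : P (N s) = 0%E.
  have [_ _ ms] := mP.
  apply: (@probability_setD_null _ _ _ P _ _ _ (measurable_reach T _)
    (measurable_reach T _) (measurable_reach T s) (@reach_rcons T s _)
    (@reach_rcons T s _) (reach_disj T s)).
  rewrite [LHS]P_reach [X in (X + _)%E]P_reach [X in (_ + X)%E]P_reach ms.
  by rewrite EFinD.
have mN s : measurable (N s).
  by apply: measurableD; [|apply: measurableU]; exact: measurable_reach.
have mD := measurable_limit_domain.
apply/(negligibleP P); first exact: measurableC.
pose F i := if @unpickle (seq bool) i is Some s then N s else set0.
have : P.-negligible (\bigcup_i F i).
  apply: negligible_bigcup => i; rewrite /F; case: (@unpickle _ i) => [s|].
    by apply/(negligibleP P); [exact: mN|exact: N0].
  exact: negligible_set0.
apply: negligibleS => z Dz; apply: contrapT => nz; apply: Dz => k.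
elim: k => [|k [s sk sz]].
  by exists [::]; rewrite ?reach_nil.
suff [b bz] : exists b, reach (rcons s b) z.
  by exists (rcons s b); rewrite ?size_rcons ?sk.
apply: contrapT => /forallNP nb; apply: nz; exists (pickle s) => //.
by rewrite /F pickleK; split => // -[/nb|/nb].
Qed.

Definition out_machine (s : seq bool) : option (seq bool) := Some (out T s).

Lemma monotone_out_machine : monotone_machine out_machine.
Proof. by move=> s s' _ _ ss' [<-] [<-]; exact: out_prefix. Qed.

Lemma out_machine_limP z y : machine_lim out_machine z y <->
  limit_domain z /\ forall j, cyl (out T (restr z j)) y.
Proof.
split => [[zy zk]|[/limit_domainP Dz zy]].
  split; last by move=> j; exact: zy.
  by apply/limit_domainP => k; have [j [u [[<-] kj]]] := zk k; exists j.
split => [j u [<-]//|k]; have [j kj] := Dz k.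
by exists j, (out T (restr z j)).
Qed.

Lemma out_machine_lim_cyl z y s :
  machine_lim out_machine z y -> cyl s y <-> reach s z.
Proof.
move=> /out_machine_limP[/limit_domainP Dz zy]; split => [sy|[j sj]]; last first.
  by apply/cyl_prefix; exists (size (out T (restr z j))); rewrite (zy j).
have [j sj] := Dz (size s); exists j; rewrite -sy -(zy j).
exact: prefix_restr.
Qed.

Lemma out_machine_lim_inj z y y' :
  machine_lim out_machine z y -> machine_lim out_machine z y' -> y = y'.
Proof.
move=> zy zy'; apply/funext => i.
have : reach (restr y i.+1) z.
  by apply/(out_machine_lim_cyl _ zy); rewrite cylE size_restr.
move=> /(out_machine_lim_cyl _ zy'); rewrite cylE size_restr !restrS.
by move=> /rcons_inj[].
Qed.

Lemma out_machine_lim_ex z : limit_domain z ->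
  exists y, machine_lim out_machine z y.
Proof.
move=> /[dup] Dz /limit_domainP zk.
have /choice[j jP] : forall k, exists j, (k < size (out T (restr z j)))%N.
  by move=> k; exact: zk.
(* The outputs form a chain, so any output longer than i supplies bit i. *)
exists (fun i => nth false (out T (restr z (j i))) i); apply/out_machine_limP.
split => // i; rewrite /cyl /=; apply: (@eq_from_nth _ false); rewrite size_restr //.
move=> l li; rewrite nth_mkseq //.
case: (leqP i (j l)) => [ij|/ltnW ij].
  have /prefixP[t ->] := out_prefix T (prefix_restr z ij).
  by rewrite nth_cat li.
have /prefixP[t ->] := out_prefix T (prefix_restr z ij).
by rewrite nth_cat jP.
Qed.

Definition limit_map (z : cantor) : option cantor :=
  if pselect (exists y, machine_lim out_machine z y) is left zy
  then Some (projT1 (cid zy)) else None.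

Lemma limit_mapP z y : limit_map z = Some y <-> machine_lim out_machine z y.
Proof.
rewrite /limit_map; case: pselect => [zy|nzy]; last first.
  by split => // zy; case: nzy; exists y.
case: cid => y' zy' /=; split => [[<-]//|zy2].
by congr Some; exact: out_machine_lim_inj zy' zy2.
Qed.

Lemma pdom_limit_map : pdom limit_map = limit_domain.
Proof.
apply/seteqP; split => z.
  by move=> [y /limit_mapP/out_machine_limP[]].
by move=> /out_machine_lim_ex[y zy]; exists y; exact/limit_mapP.
Qed.

Lemma ppreimage_limit_map_cyl s :
  ppreimage limit_map (cyl s) = limit_domain `&` reach s.
Proof.
apply/seteqP; split => z.
  move=> [y sy /limit_mapP zy]; split; last exact/(out_machine_lim_cyl _ zy).
  by case/out_machine_limP: zy.
move=> [/out_machine_lim_ex[y zy] zs]; exists y; last exact/limit_mapP.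
exact/(out_machine_lim_cyl _ zy).
Qed.

(** A total measurable map is needed in order to form the image measure [distribution]. *)
Definition total_limit_map (z : cantor) : cantor :=
  odflt (fun=> false) (limit_map z).

Lemma ppreimage_limit_map B :
  ppreimage limit_map B = limit_domain `&` total_limit_map @^-1` B.
Proof.
apply/seteqP; split => z.
  move=> [y By zy]; split; last by rewrite /total_limit_map /= zy.
  by rewrite -pdom_limit_map; exists y.
rewrite -pdom_limit_map /total_limit_map => -[[y zy]] /=.
by rewrite zy => By; exists y.
Qed.

Lemma measurable_total_limit_map : measurable_fun setT total_limit_map.
Proof.
apply: measurable_fun_cantor => i.
apply: (@measurable_fun_bool _ _ _ _ true); rewrite setTI.
(* The default value is constantly false, so bit i can be true only on the domain. *)
have -> : (fun z => total_limit_map z i) @^-1` [set true] =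
  \bigcup_s if (size s == i.+1) && nth false s i
    then ppreimage limit_map (cyl s) else set0.
  apply/seteqP; split => [z /= zi|z [s _]].
    exists (restr (total_limit_map z) i.+1) => //.
    rewrite size_restr eqxx nth_mkseq // zi ppreimage_limit_map.
    split; last by rewrite /preimage mksetE cylE size_restr.
    move: zi; rewrite /total_limit_map -pdom_limit_map.
    by case E : (limit_map z) => [y|//] _; exists y.
  case: ifP => // /andP[/eqP si ti]; rewrite ppreimage_limit_map => -[_].
  by rewrite /preimage mksetE cylE si => sz; move: ti; rewrite -sz nth_mkseq.
apply: countable_bigcupT_measurable => [|s]; first exact: countableP.
case: ifP => // _; rewrite ppreimage_limit_map_cyl.
by apply: measurableI; [exact: measurable_limit_domain|exact: measurable_reach].
Qed.

Lemma limit_domainI_measure A : measurable A -> P (limit_domain `&` A) = P A.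
Proof.
move=> mA; have mD := measurable_limit_domain.
have A0 : P (A `\` limit_domain) = 0%E.
  apply: (subset_measure0 _ _ _ limit_domainC_null).
  - exact: measurableD.
  - exact: measurableC.
  - exact: subIsetr.
rewrite setIC; apply/esym/(etrans (measureDI P mA mD)).
by rewrite [X in (X + _)%E]A0 add0e.
Qed.

Lemma limit_map_preserving (mu : probability cantor R) :
  (forall s, mu (cyl s) = (m s)%:E) -> measure_preserving P mu limit_map.
Proof.
move=> mum B mB.
have mf := measurable_total_limit_map.
have mfB A : measurable A -> measurable (total_limit_map @^-1` A).
  by move=> mA; rewrite -[X in measurable X]setTI; exact: mf.
pose f : {mfun cantor >-> cantor} :=
  HB.pack total_limit_map (isMeasurableFun.Build _ _ _ _ total_limit_map mf).
split.
  rewrite ppreimage_limit_map; apply: measurableI; last exact: mfB.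
  exact: measurable_limit_domain.
rewrite ppreimage_limit_map limit_domainI_measure; last exact: mfB.
apply: (probability_cyl_unique (P := mu) (Q := distribution P f)) => // s.
rewrite mum -P_reach /distribution /pushforward.
rewrite -[LHS]limit_domainI_measure; last exact: measurable_reach.
rewrite -ppreimage_limit_map_cyl ppreimage_limit_map.
by rewrite limit_domainI_measure //; apply: mfB; exact: measurable_cyl.
Qed.

Lemma limit_map_ae_computable :
  partial_computable_machine out_machine -> ae_computable P limit_map.
Proof.
move=> oc; split.
  exists out_machine; split => //; first exact: monotone_out_machine.
  exact: limit_mapP.
rewrite pdom_limit_map -[limit_domain]setIT limit_domainI_measure //.
exact: probability_setT.
Qed.

End limit_map.

(** * Certifying membership in I_k(s) *)

Section approximation.
Context (gm gn : nat -> nat -> nat).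

(** All values are in units of 2^-q. Precision q - k for [gn] yields 2^-k n directly in these units,
    with an error of at most one unit. *)
Definition quota0_approx (k q p r : nat) : nat :=
  maxn (r - gm (code_rcons p true) q)
    (minn (gm (code_rcons p false) q) (gn (code_rcons p false) (q - k))).

Definition quota_approx (k q a i : nat) : nat :=
  rec (2 ^ (q - k)) (fun i r =>
    let r0 := quota0_approx k q (code_take a i) r in
    if code_nth a i then (r - r0)%N else r0) i.

Definition offset_approx (k q a i : nat) : nat :=
  rec (2 ^ (q - k)) (fun i h =>
    (h + (if code_nth a i then quota_approx k q a i - quota_approx k q a i.+1
          else 0))%N) i.

Lemma offset_approxS k q a i : offset_approx k q a i.+1 =
  (offset_approx k q a i + if code_nth a i
    then quota_approx k q a i - quota_approx k q a i.+1 else 0)%N.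
Proof. by []. Qed.

(* The margin [2 ^ (l + 3)] covers the rounding errors, in units of [2 ^ -q], of
   the two offsets (at most [3 * 2 ^ l] each) and quotas ([2 ^ l] each). *)
Definition itv_test (k q a v : nat) : bool :=
  let l := code_size a in
  [&& k < q,
      offset_approx k q a l + 2 ^ (l + 3) <= v + offset_approx k.+1 q a l &
      v + 1 + 2 ^ (l + 3) + (offset_approx k.+1 q a l + quota_approx k.+1 q a l)
        <= offset_approx k q a l + quota_approx k q a l]%N.

Context (R : realType) (m n : seq bool -> R).
Hypotheses (mP : prob_on_strings m) (nP : prob_on_strings n).
Hypothesis gmP : forall s q, dyadic_approx (m s) q (gm (str_code s) q).
Hypothesis gnP : forall s q, dyadic_approx (n s) q (gn (str_code s) q).

Lemma dyadic_approx_scaled (r : R) q p :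
  dyadic_approx r q p -> `|p%:R - 2 ^+ q * r| <= 1.
Proof.
have q0 : 0 < 2 ^+ q :> R by rewrite exprn_gt0.
rewrite /dyadic_approx => rp.
have -> : p%:R - 2 ^+ q * r = - (2 ^+ q * (r - p%:R / 2 ^+ q)).
  by field; rewrite gt_eqF.
rewrite normrN normrM gtr0_norm //.
by rewrite -[leRHS](mulfV (lt0r_neq0 q0)) ler_pM2l.
Qed.

Lemma natr_subn_max (a b : nat) : (a - b)%:R = Num.max 0 (a%:R - b%:R) :> R.
Proof.
case: (leqP a b) => [ab|/ltnW ab].
  by rewrite (eqP ab) max_l // subr_le0 ler_nat.
by rewrite natrB // max_r // subr_ge0 ler_nat.
Qed.

Lemma natr_maxn (a b : nat) : (maxn a b)%:R = Num.max a%:R b%:R :> R.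
Proof.
by case: (leqP a b) => [ab|/ltnW ab]; [rewrite max_r|rewrite max_l]; rewrite ?ler_nat.
Qed.

Lemma natr_minn (a b : nat) : (minn a b)%:R = Num.min a%:R b%:R :> R.
Proof.
by case: (leqP a b) => [ab|/ltnW ab]; [rewrite min_l|rewrite min_r]; rewrite ?ler_nat.
Qed.

Lemma max_approx (x y x' y' e : R) : `|x' - x| <= e -> `|y' - y| <= e ->
  `|Num.max x' y' - Num.max x y| <= e.
Proof.
by rewrite !ler_norml; have [h|h] := leP x y; have [h'|h'] := leP x' y'; lra.
Qed.

Lemma min_approx (x y x' y' e : R) : `|x' - x| <= e -> `|y' - y| <= e ->
  `|Num.min x' y' - Num.min x y| <= e.
Proof.
by rewrite !ler_norml; have [h|h] := leP x y; have [h'|h'] := leP x' y'; lra.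
Qed.

(** The extra maximum with 0 comes from truncated subtraction; on the exact side it changes nothing,
    since min(m0, c) >= 0. *)
Lemma maxmin_approx (r m0 m1 c r' m0' m1' c' e : R) :
  0 <= m0 -> 0 <= c -> `|r' - r| <= e -> `|m0' - m0| <= 1 ->
  `|m1' - m1| <= 1 -> `|c' - c| <= 1 ->
  `|Num.max (Num.max 0 (r' - m1')) (Num.min m0' c') -
    Num.max (r - m1) (Num.min m0 c)| <= e + 1.
Proof.
move=> m0_ge0 c_ge0 rr mm0 mm1 cc.
have e0 : 0 <= e by exact: le_trans rr.
have -> : Num.max (r - m1) (Num.min m0 c) =
    Num.max (Num.max 0 (r - m1)) (Num.min m0 c).
  by rewrite [Num.max 0 _]maxC -maxA (@max_r _ _ 0) // le_min m0_ge0.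
apply: max_approx; first apply: max_approx.
- by rewrite subrr normr0; lra.
- by move: rr mm1; rewrite !ler_norml; lra.
- by apply: min_approx; lra.
Qed.

Lemma sub_approx (x y d e : R) (x' y' : nat) : y <= x ->
  `|x'%:R - x| <= d -> `|y'%:R - y| <= e -> `|(x' - y')%:R - (x - y)| <= d + e.
Proof.
move=> yx xd ye; rewrite natr_subn_max.
have [h|h] := leP 0 (x'%:R - y'%:R : R); move: xd ye; rewrite !ler_norml; lra.
Qed.

(** The initial value 2^(q-k) is exact. An error e at the parent gives e + 1 at the left child and e
    + (e + 1) at the right one, hence 2^i - 1 at depth i. *)
Lemma quota_approxP k q s i : (k <= q)%N -> (i <= size s)%N ->
  `|(quota_approx k q (str_code s) i)%:R -
    2 ^+ q * quota m n (level R k) (take i s)| <= 2 ^+ i - 1.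
Proof.
move=> kq; have q0 : 0 < 2 ^+ q :> R by rewrite exprn_gt0.
have qk : 2 ^+ q * level R k = 2 ^+ (q - k).
  by rewrite /level -{1}(subnK kq) exprD mulfK // gt_eqF // exprn_gt0.
elim: i => [|i IHi] ilt.
  by rewrite take0 quota_nil qk /quota_approx /= natrX subrr normr0 expr0 subrr.
have {}IHi := IHi (ltnW ilt).
rewrite /quota_approx /= -/(quota_approx _ _ _ _) (take_nth false) // quota_rcons.
rewrite code_takeE ?(ltnW ilt) // code_nthE.
move: IHi; set t := take i s; set r' := quota_approx _ _ _ _.
set r := quota m n (level R k) t => IHi.
have [m_ge0 _ _] := mP; have [n_ge0 _ _] := nP.
have H0 : `|(quota0_approx k q (str_code t) r')%:R -
    2 ^+ q * quota0 m n (level R k) t r| <= (2 ^+ i - 1) + 1.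
  rewrite /quota0_approx /quota0 !code_rconsE.
  rewrite natr_maxn natr_minn natr_subn_max.
  rewrite !(maxr_pMr, minr_pMr) ?(ltW q0) // mulrBr mulrA qk.
  apply: maxmin_approx => //.
  - by rewrite mulr_ge0 // ltW.
  - by rewrite mulr_ge0 // exprn_ge0.
  - exact/dyadic_approx_scaled/gmP.
  - exact/dyadic_approx_scaled/gmP.
  - exact/dyadic_approx_scaled/gnP.
have i1 : 1 <= 2 ^+ i :> R by rewrite exprn_ege1 // ler1n.
rewrite exprS; case: nth; last by lra.
have r0r : 0 <= 2 ^+ q * (r - quota0 m n (level R k) t r).
  rewrite mulr_ge0 ?(ltW q0) // subr_ge0.
  have := quota_split m n (level R k) t; rewrite !quota_rcons -/r => e.
  have := quota_ge0 mP nP (rcons t true) (_ : 0 <= level R k <= 1).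
  by rewrite ltW ?level_gt0 // level_le1 quota_rcons -/r => /(_ erefl); lra.
have -> : 2 * 2 ^+ i - 1 = (2 ^+ i - 1) + (2 ^+ i - 1 + 1) :> R by ring.
by rewrite mulrBr in r0r *; apply: sub_approx => //; rewrite -subr_ge0.
Qed.

(** Step i adds at most the errors of two quotas, (2^i - 1) + (2^(i+1) - 1), which is below 3 *
    2^i. *)
Lemma offset_approxP k q s i : (k <= q)%N -> (i <= size s)%N ->
  `|(offset_approx k q (str_code s) i)%:R -
    2 ^+ q * offset m n (level R k) (take i s)| <= 3 * (2 ^+ i - 1).
Proof.
move=> kq; have q0 : 0 < 2 ^+ q :> R by rewrite exprn_gt0.
have qk : 2 ^+ q * level R k = 2 ^+ (q - k).
  by rewrite /level -{1}(subnK kq) exprD mulfK // gt_eqF // exprn_gt0.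
elim: i => [|i IHi] ilt.
  by rewrite take0 /offset /= qk natrX subrr normr0 expr0 subrr mulr0.
have {}IHi := IHi (ltnW ilt).
have H0 := quota_approxP kq (ltnW ilt); have H1 := quota_approxP kq ilt.
have i1 : 1 <= 2 ^+ i :> R by rewrite exprn_ege1 // ler1n.
have s1 := take_nth false ilt.
move: H1; rewrite offset_approxS code_nthE s1 offset_rcons exprS => H1.
case: (nth false s i) in H1 *; last first.
  by rewrite addn0 addr0; apply: le_trans IHi _; lra.
have l01 : 0 <= level R k <= 1 by rewrite ltW ?level_gt0 // level_le1.
have le01 : 2 ^+ q * quota m n (level R k) (rcons (take i s) true) <=
    2 ^+ q * quota m n (level R k) (take i s).
  by rewrite ler_pM2l // [leRHS]quota_split lerDr quota_ge0.
have := sub_approx le01 H0 H1.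
by move: IHi; rewrite natrD !ler_norml; lra.
Qed.

Lemma itv_test_sound k q s v : itv_test k q (str_code s) v ->
  [/\ (k < q)%N, itv_lo m n k s <= v%:R * level R q &
      v%:R * level R q + level R q <= itv_hi m n k s].
Proof.
rewrite /itv_test code_sizeE => /and3P[kq].
have := offset_approxP kq (leqnn (size s)).
have := offset_approxP (ltnW kq) (leqnn (size s)).
have := quota_approxP kq (leqnn (size s)).
have := quota_approxP (ltnW kq) (leqnn (size s)).
rewrite take_size !ler_norml -!(ler_nat R) !natrD !natrX exprD.
have q0 : 0 < 2 ^+ q :> R by rewrite exprn_gt0.
have qq x y : (x <= y) = (2 ^+ q * x <= 2 ^+ q * y) :> bool by rewrite ler_pM2l.
have qV : 2 ^+ q * level R q = 1 by rewrite mulfV // gt_eqF.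
have qvV : 2 ^+ q * (v%:R * level R q) = v%:R by rewrite mulrCA qV mulr1.
rewrite /itv_lo /itv_hi => H1 H2 H3 H4 H5 H6; split;
  first (by rewrite ler_nat); rewrite qq.
  by rewrite qvV; lra.
by rewrite [leLHS]mulrDr qvV qV; lra.
Qed.

Lemma itv_test_complete k s r : itv_lo m n k s < r < itv_hi m n k s ->
  exists J, forall q v, (J <= q)%N -> (k < q)%N ->
    v%:R * level R q <= r < v%:R * level R q + level R q ->
    itv_test k q (str_code s) v.
Proof.
move=> /andP[lor rhi].
(* In units of 2^-q: 8 * 2^|s| for the margin of the test, as much for the rounding errors, and 1
   for the length of the dyadic interval. *)
pose C : R := 1 + 16 * 2 ^+ size s.
have C0 : 0 < C by rewrite addr_gt0 // mulr_gt0 // exprn_gt0.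
have [J1 J1P] := @level_small R ((r - itv_lo m n k s) / C)
  ltac:(by rewrite divr_gt0 // subr_gt0).
have [J2 J2P] := @level_small R ((itv_hi m n k s - r) / C)
  ltac:(by rewrite divr_gt0 // subr_gt0).
rewrite ltr_pdivlMr // in J1P; rewrite ltr_pdivlMr // in J2P.
exists (maxn J1 J2) => q v; rewrite geq_max => /andP[q1 q2] kq /andP[vr rv].
have q0 : 0 < 2 ^+ q :> R by rewrite exprn_gt0.
have qV : 2 ^+ q * level R q = 1 by rewrite mulfV // gt_eqF.
have qvV : 2 ^+ q * (v%:R * level R q) = v%:R by rewrite mulrCA qV mulr1.
have small J : (J <= q)%N -> C <= 2 ^+ q * (level R J * C).
  move=> Jq; rewrite mulrA ler_peMl ?(ltW C0) // -[leLHS]qV ler_pM2l //.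
  by rewrite /level lef_pV2 ?posrE ?exprn_gt0 // ler_eXn2l // ltr1n.
have := small _ q1; have := small _ q2.
rewrite -(ltr_pM2l q0) in J1P; rewrite -(ltr_pM2l q0) in J2P.
rewrite -(ler_pM2l q0) qvV in vr; rewrite -(ltr_pM2l q0) mulrDr qvV qV in rv.
move: J1P J2P vr rv.
rewrite /itv_test code_sizeE kq /=.
have := offset_approxP kq (leqnn (size s)).
have := offset_approxP (ltnW kq) (leqnn (size s)).
have := quota_approxP kq (leqnn (size s)).
have := quota_approxP (ltnW kq) (leqnn (size s)).
rewrite take_size !ler_norml -!(ler_nat R) !natrD !natrX exprD.
rewrite /itv_lo /itv_hi /C => H1 H2 H3 H4 H5 H6 H7 H8 H9 H10.
by apply/andP; split; lra.
Qed.

End approximation.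

Local Open Scope nat_scope.

Local Open Scope nat_scope.

(** * The machine as a primitive recursion on codes *)

Definition string_num (s : seq bool) : nat :=
  foldl (fun v (b : bool) => v + v + b) 0 s.

(** As with [find], the value is the length j as long as no one has been seen; [h < j] means that
    one was found. *)
Definition code_first (a j : nat) : nat :=
  rec 0 (fun j h => if h < j then h else j + ~~ code_nth a j) j.

Definition code_num (a j : nat) : nat :=
  rec 0 (fun j v => v + v + code_nth a j) j.

Lemma code_firstE s j : j <= size s ->
  code_first (str_code s) j = find id (take j s).
Proof.
elim: j => [|j IHj] ilt; first by rewrite take0.
rewrite /code_first /= -/(code_first _ _) (IHj (ltnW ilt)) code_nthE.
rewrite (take_nth false) // -cats1 find_cat has_find size_takel ?(ltnW ilt) //=.
by case: ifP => // _; case: nth.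
Qed.

Lemma code_numE s j : j <= size s ->
  code_num (str_code s) j = string_num (take j s).
Proof.
elim: j => [|j IHj] ilt; first by rewrite take0.
rewrite /code_num /= -/(code_num _ _) (IHj (ltnW ilt)) code_nthE.
by rewrite (take_nth false) // /string_num foldl_rcons.
Qed.

Lemma computable_negb n (b : seq nat -> bool) :
  computable n b -> computable n (fun v => ~~ b v).
Proof.
move=> cb; apply: (@eq_computable n (fun v => 1 - b v)).
  by move=> v _; case: (b v).
by apply: computable_sub => //; exact: computable_const.
Qed.

Lemma computable_code_first n f g : computable n f -> computable n g ->
  computable n (fun v => code_first (f v) (g v)).
Proof.
apply: (@computable2 n code_first).
apply: (@computable_rec2 2 (nth 0 ^~ 1) (fun=> 0)
  (fun j h v => if h < j then h else j + ~~ code_nth (nth 0 v 0) j)) => //;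
  computability.
apply: computable_if; computability.
apply: computable_negb; apply: computable_code_nth; computability.
Qed.

Lemma computable_code_num n f g : computable n f -> computable n g ->
  computable n (fun v => code_num (f v) (g v)).
Proof.
apply: (@computable2 n code_num).
apply: (@computable_rec2 2 (nth 0 ^~ 1) (fun=> 0)
  (fun j v w => v + v + code_nth (nth 0 w 0) j)) => //; computability.
apply: computable_code_nth; computability.
Qed.

Section computable_machine.
Context (gm gn : nat -> nat -> nat).

(** The precision is the length of the input read, so the approximations sharpen as the dyadic
    interval shrinks. *)
Definition prefix_test (s u : seq bool) : bool :=
  itv_test gm gn (find id s) (size s) (str_code u) (string_num s).

Definition code_out (a j : nat) : nat :=
  rec 0 (fun j u =>
    let k := code_first a j.+1 in
    let v := code_num a j.+1 in
    if itv_test gm gn k j.+1 (code_rcons u false) v then code_rcons u false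
    else if itv_test gm gn k j.+1 (code_rcons u true) v then code_rcons u true
    else u) j.

Lemma code_outS a j : code_out a j.+1 =
  let k := code_first a j.+1 in
  let v := code_num a j.+1 in
  if itv_test gm gn k j.+1 (code_rcons (code_out a j) false) v
  then code_rcons (code_out a j) false
  else if itv_test gm gn k j.+1 (code_rcons (code_out a j) true) v
  then code_rcons (code_out a j) true else code_out a j.
Proof. by []. Qed.

Lemma code_outE s j : j <= size s ->
  code_out (str_code s) j = str_code (out prefix_test (take j s)).
Proof.
elim: j => [|j IHj] ilt; first by rewrite take0.
rewrite (take_nth false) // out_rcons -(take_nth false) //.
rewrite code_outS (IHj (ltnW ilt)) code_firstE // code_numE //.
by rewrite !code_rconsE /prefix_test size_takel //; do 2 case: ifP => //.
Qed.

Hypothesis cgm : computable 2 (fun v => gm (nth 0 v 0) (nth 0 v 1)).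
Hypothesis cgn : computable 2 (fun v => gn (nth 0 v 0) (nth 0 v 1)).

Lemma computable_quota_approx : computable 4 (fun v =>
  quota_approx gm gn (nth 0 v 0) (nth 0 v 1) (nth 0 v 2) (nth 0 v 3)).
Proof.
apply: (@computable_rec2 4 (nth 0 ^~ 3) (fun v => 2 ^ (nth 0 v 1 - nth 0 v 0))
  (fun i r v => let r0 := quota0_approx gm gn (nth 0 v 0) (nth 0 v 1)
      (code_take (nth 0 v 2) i) r in
    if code_nth (nth 0 v 2) i then r - r0 else r0)) => //; try by computability.
have cq : computable 6 (fun w => quota0_approx gm gn
    (nth 0 (behead (behead w)) 0) (nth 0 (behead (behead w)) 1)
    (code_take (nth 0 (behead (behead w)) 2) (nth 0 w 0)) (nth 0 w 1)).
  have ct : computable 6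
      (fun w => code_take (nth 0 (behead (behead w)) 2) (nth 0 w 0)).
    by apply: computable_code_take; computability.
  have cr b : computable 6 (fun w =>
      code_rcons (code_take (nth 0 (behead (behead w)) 2) (nth 0 w 0)) b).
    by apply: computable_code_rcons => //; exact: computable_const.
  apply: computable_max.
    apply: computable_sub; first by computability.
    by apply: (computable2 cgm); [exact: cr|computability].
  apply: computable_min.
    by apply: (computable2 cgm); [exact: cr|computability].
  by apply: (computable2 cgn); [exact: cr|computability].
apply: computable_if => //; last exact: computable_sub (computable_proj _ _) cq.
by apply: computable_code_nth; computability.
Qed.

Lemma computable_offset_approx : computable 4 (fun v =>
  offset_approx gm gn (nth 0 v 0) (nth 0 v 1) (nth 0 v 2) (nth 0 v 3)).
Proof.
apply: (@computable_rec2 4 (nth 0 ^~ 3) (fun v => 2 ^ (nth 0 v 1 - nth 0 v 0))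
  (fun i h v => h + if code_nth (nth 0 v 2) i then
    quota_approx gm gn (nth 0 v 0) (nth 0 v 1) (nth 0 v 2) i -
    quota_approx gm gn (nth 0 v 0) (nth 0 v 1) (nth 0 v 2) i.+1 else 0)) => //;
  try by computability.
apply: computable_add; first by computability.
apply: computable_if.
- by apply: computable_code_nth; computability.
- by apply: computable_sub; apply: (computable4 computable_quota_approx);
    computability.
- exact: computable_const.
Qed.

Lemma computable_itv_test n f0 f1 f2 f3 :
  computable n f0 -> computable n f1 -> computable n f2 -> computable n f3 ->
  computable n (fun v => itv_test gm gn (f0 v) (f1 v) (f2 v) (f3 v)).
Proof.
move=> c0 c1 c2 c3; have cl := computable_code_size c2.
have cq k : computable n k -> computable n (fun v =>
    quota_approx gm gn (k v) (f1 v) (f2 v) (code_size (f2 v))).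
  by move=> ck; exact: (computable4 computable_quota_approx).
have co k : computable n k -> computable n (fun v =>
    offset_approx gm gn (k v) (f1 v) (f2 v) (code_size (f2 v))).
  by move=> ck; exact: (computable4 computable_offset_approx).
have ce : computable n (fun v => 2 ^ (code_size (f2 v) + 3)).
  by apply/computable_exp2/computable_add => //; exact: computable_const.
have cS := computable_succ c0.
apply: computable_and; first exact: computable_leq.
apply: computable_and; apply: computable_leq.
- by apply: computable_add ce; exact: co.
- by apply: computable_add => //; exact: co.
- apply: computable_add; last by apply: computable_add; [exact: co|exact: cq].
  by apply: computable_add ce; apply: computable_add => //; exact: computable_const.
- by apply: computable_add; [exact: co|exact: cq].
Qed.

Lemma computable_code_out n f g : computable n f -> computable n g ->
  computable n (fun v => code_out (f v) (g v)).
Proof.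
apply: (@computable2 n code_out).
apply: (@computable_rec2 2 (nth 0 ^~ 1) (fun=> 0)
  (fun j u v =>
    let k := code_first (nth 0 v 0) j.+1 in
    let w := code_num (nth 0 v 0) j.+1 in
    if itv_test gm gn k j.+1 (code_rcons u false) w then code_rcons u false
    else if itv_test gm gn k j.+1 (code_rcons u true) w then code_rcons u true
    else u)) => //; try by computability.
have cr b : computable 4 (fun w => code_rcons (nth 0 w 1) b).
  by apply: computable_code_rcons; computability.
have ct b : computable 4 (fun w => itv_test gm gn
    (code_first (nth 0 (behead (behead w)) 0) (nth 0 w 0).+1) (nth 0 w 0).+1
    (code_rcons (nth 0 w 1) b)
    (code_num (nth 0 (behead (behead w)) 0) (nth 0 w 0).+1)).
  apply: computable_itv_test => //.
  - by apply: computable_code_first; computability.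
  - by computability.
  - by apply: computable_code_num; computability.
apply: computable_if (ct false) (cr false) _.
by apply: computable_if (ct true) (cr true) _; computability.
Qed.

Lemma computable_out_machine : partial_computable_machine (out_machine prefix_test).
Proof.
have [c cP] : computable 1 (fun v => code_out (nth 0 v 0) (code_size (nth 0 v 0))).
  apply: computable_code_out; first by computability.
  by apply: computable_code_size; computability.
exists c => s u; have := cP [:: str_code s] erefl.
rewrite /= code_sizeE code_outE // take_size => cs; split => [[<-]//|].
by move=> /(eval_functional cs)/str_code_inj us; congr Some.
Qed.

Context (R : realType) (m n : seq bool -> R).
Hypotheses (mP : prob_on_strings m) (nP : prob_on_strings n).
Hypothesis gmP : forall s q, dyadic_approx (m s) q (gm (str_code s) q).
Hypothesis gnP : forall s q, dyadic_approx (n s) q (gn (str_code s) q).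
Local Open Scope ring_scope.

Lemma string_valE s : string_val R s = (string_num s)%:R * level R (size s).
Proof.
elim/last_ind: s => [|s b IHs]; first by rewrite mul0r.
rewrite string_val_rcons IHs /string_num foldl_rcons -/(string_num s) size_rcons.
by rewrite [level R (size s)]levelS !natrD; ring.
Qed.

Lemma prefix_test_sound s u : prefix_test s u -> certified m n s u.
Proof.
by move=> /(itv_test_sound mP nP gmP gnP); rewrite /certified string_valE.
Qed.

Lemma prefix_test_complete k u r : itv_lo m n k u < r < itv_hi m n k u ->
  exists J, forall s, (J <= size s)%N -> (find id s < size s)%N ->
  find id s = k -> string_val R s <= r < string_val R s + level R (size s) ->
  prefix_test s u.
Proof.
move=> /(itv_test_complete mP nP gmP gnP)[J JP]; exists J => s Js fs sk.
by rewrite string_valE => sr; rewrite /prefix_test sk; apply: JP => //; rewrite -sk.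
Qed.

End computable_machine.

Local Open Scope ring_scope.

(** * Large values of nu / mu along x0 *)

(** The use principle: a halting computation consists of finitely many halting subcomputations, and
    the maximum of their uses, added to that of the main one, is a bound. *)
Lemma eval_use x c v r : eval x c v r ->
  exists N, forall y : nat -> bool,
    (forall i, (i < N)%N -> y i = x i) -> eval y c v r.
Proof.
elim: c v r => [||i||k f IHf g IHg|f IHf g IHg|f IHf] v r /=;
  try by move=> ->; exists 0%N.
- by move=> ->; exists (head 0%N v).+1 => y -> //.
- move=> [w [gw /IHf[N fN]]].
  have /choice[M gM] : forall i, exists N, forall y : nat -> bool,
      (forall i, (i < N)%N -> y i = x i) -> eval y (g i) v (w i).
    by move=> i; exact: IHg (gw i).
  exists (N + \max_i M i)%N => y yx; exists w; split => [i|].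
    apply: gM => j jM; apply: yx; apply: (leq_trans jM).
    by apply: leq_trans (leq_addl _ _); exact: leq_bigmax.
  by apply: fN => j jN; apply: yx; exact: leq_trans (leq_addr _ _).
- move=> [h [/IHf[N fN] gh ->]].
  have /choice[M gM] : forall i, exists N, (i < head 0 v)%N ->
      forall y : nat -> bool, (forall i, (i < N)%N -> y i = x i) ->
      eval y g [:: i, h i & behead v] (h i.+1).
    move=> i; case: (ltnP i (head 0%N v)) => [iv|_]; last by exists 0%N.
    by have [M MP] := IHg _ _ (gh i iv); exists M.
  exists (N + \max_(i < head 0%N v) M i)%N => y yx; exists h; split => // [|i iv].
    by apply: fN => j jN; apply: yx; exact: leq_trans (leq_addr _ _).
  apply: (gM i iv) => j jM; apply: yx; apply: (leq_trans jM).
  apply: leq_trans (leq_addl _ _).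
  exact: (leq_bigmax (F := fun i : 'I_(head 0%N v) => M i) (Ordinal iv)).
- move=> [/IHf[N fN] lr].
  (* The unsuccessful trials i < r of the search halt as well, so each has a finite use. *)
  have /choice[M fM] : forall i, exists N, (i < r)%N -> exists k,
      forall y : nat -> bool, (forall i, (i < N)%N -> y i = x i) ->
      eval y f (i :: v) k.+1.
    move=> i; case: (ltnP i r) => [ir|_]; last by exists 0%N.
    by have [k /IHf[M MP]] := lr i ir; exists M => _; exists k.
  exists (N + \max_(i < r) M i)%N => y yx; split => [|i ir].
    by apply: fN => j jN; apply: yx; exact: leq_trans (leq_addr _ _).
  have [k kP] := fM i ir; exists k; apply: kP => j jM; apply: yx.
  apply: (leq_trans jM); apply: leq_trans (leq_addl _ _).
  exact: (leq_bigmax (F := fun i : 'I_r => M i) (Ordinal ir)).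
Qed.

Lemma cyl_restr_nth (x y : cantor) N i :
  cyl (restr x N) y -> (i < N)%N -> y i = x i.
Proof.
rewrite cylE size_restr => yx iN.
by have /(congr1 (fun s => nth false s i)) := yx; rewrite !nth_mkseq.
Qed.

Lemma cyl_restr_le (x : cantor) i j :
  (i <= j)%N -> cyl (restr x j) `<=` cyl (restr x i).
Proof. by move=> /(prefix_restr x)/prefixP[t ->]; exact: cyl_cat. Qed.

Section blowup.
Context (R : realType).

(** Near [x] the program returns the same approximation, so the two values differ by at most 2 *
    2^-k. *)
Lemma computable_fun_seq_continuous (f : nat -> cantor -> R) (x : cantor) i
    (e : R) :
  computable_fun_seq f -> 0 < e ->
  exists N, forall y, cyl (restr x N) y -> f i x - e <= f i y.
Proof.
move=> [_ [c cP]] e0; have [k ke] := @level_small R (e / 2) ltac:(by rewrite divr_gt0).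
have [p /eval_use[N NP] fxp] := cP i x k; exists N => y xy.
have [p' yp fyp] := cP i y k.
have pp : p = p'.
  by apply: eval_functional yp; apply: NP => j; exact: cyl_restr_nth xy.
move: fxp fyp; rewrite /dyadic_approx -pp -/(level R k) !ler_norml.
by move: ke; lra.
Qed.

Lemma computable_fun_seq_sum_continuous (f : nat -> cantor -> R) (x : cantor) M
    (e : R) :
  computable_fun_seq f -> 0 < e ->
  exists N, forall y, cyl (restr x N) y ->
    \sum_(i < M) f i x - e <= \sum_(i < M) f i y.
Proof.
move=> cf; elim: M e => [|M IHM] e e0.
  by exists 0%N => y _; rewrite !big_ord0; lra.
have e2 : 0 < e / 2 by rewrite divr_gt0.
have [N1 N1P] := IHM _ e2.
have [N2 N2P] := computable_fun_seq_continuous x M cf e2.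
exists (maxn N1 N2) => y xy; rewrite !big_ord_recr /=.
have := N1P y (cyl_restr_le (leq_maxl _ _) xy).
have := N2P y (cyl_restr_le (leq_maxr _ _) xy); lra.
Qed.

(** Nonnegative integrals are suprema over simple functions below the integrand, so [t] can be
    bounded without proving it measurable. *)
Lemma ge0_le_integral_nonmeasurable d (T : measurableType d)
    (mu : {measure set T -> \bar R}) (D : set T) (f g : T -> \bar R) :
  (forall x, D x -> 0 <= f x)%E -> (forall x, D x -> f x <= g x)%E ->
  (\int[mu]_(x in D) f x <= \int[mu]_(x in D) g x)%E.
Proof.
move=> f0 fg; have g0 x : D x -> (0 <= g x)%E.
  by move=> Dx; exact: le_trans (f0 x Dx) (fg x Dx).
rewrite !ge0_integralE //; apply: ereal_sup_le => _ [h hf <-].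
by exists h => // x; exact: le_trans (hf x) (lee_restrict fg x).
Qed.

Lemma lower_semicomputable_blowup (mu nu : probability cantor R)
    (t : cantor -> \bar R) (x : cantor) (C : R) :
  lower_semicomputable t -> ~ (t x < +oo)%E -> 0 <= C ->
  (forall s, \int[mu]_(y in cyl s) t y <= nu (cyl s))%E ->
  exists N, C * fine (mu (cyl (restr x N))) <= fine (nu (cyl (restr x N))).
Proof.
move=> [f cf tf] tx C0 tnu; have f0 i y : (0 <= (f i y)%:E)%E.
  by rewrite lee_fin; case: cf.
(* The extra 1 is what the partial sum may lose on a neighbourhood of [x]; there t >= C, and
   integrating gives C mu <= nu. *)
have [M CM] : exists M, C + 1 <= \sum_(i < M) f i x.
  apply: contrapT => /forallNP noM; apply: tx.
  apply: (@le_lt_trans _ _ (C + 1)%:E); last exact: ltry.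
  rewrite tf; apply: lime_le; first by apply: is_cvg_nneseries => i _ _.
  apply: nearW => M; rewrite big_mkord sumEFin lee_fin leNgt.
  by apply/negP => /ltW /(noM M).
have [N NP] := computable_fun_seq_sum_continuous x M cf (@ltr01 R).
exists N; have mC := measurable_cyl (restr x N).
rewrite -lee_fin EFinM !fineK ?fin_num_measure // -integral_cst //.
apply: le_trans (tnu _); apply: ge0_le_integral_nonmeasurable => y xy.
  by rewrite lee_fin.
rewrite tf; apply: (@le_trans _ _ (\sum_(0 <= i < M) (f i y)%:E)%E).
  by rewrite big_mkord sumEFin lee_fin; have := NP y xy; lra.
by apply: nneseries_lim_ge => i _ _.
Qed.

End blowup.

(** Every number is the code of exactly one string, so the program of the measure defines a total
    function of the code and the precision. *)
Lemma computable_measure_approx (R : realType) (mu : probability cantor R) :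
  computable_measure mu -> exists g : nat -> nat -> nat,
    computable 2 (fun v => g (nth 0%N v 0) (nth 0%N v 1)) /\
    forall s q, dyadic_approx (fine (mu (cyl s))) q (g (str_code s) q).
Proof.
move=> [c cP].
have /choice[g gP] : forall aq : nat * nat, exists p,
    eval0 c [:: aq.1; aq.2] p /\
    forall s, str_code s = aq.1 -> dyadic_approx (fine (mu (cyl s))) aq.2 p.
  move=> [a q]; have [s <-] := str_code_surj a.
  by have [p cp mp] := cP s q; exists p; split => // s' /str_code_inj ->.
exists (fun a q => g (a, q)); split.
  by exists c => -[|a [|q [|]]] //= _; exact: (gP (a, q)).1.
by move=> s q; apply: (gP (str_code s, q)).2.
Qed.

Lemma find_prefix (s t : seq bool) :
  prefix s t -> (find id s < size s)%N -> find id t = find id s.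
Proof. by move=> /prefixP[u ->] hs; rewrite find_cat has_find hs. Qed.

Theorem theorem6p1 (R : realType) (mu : probability cantor R) (x0 : cantor) :
  computable_measure mu -> ~ computably_random mu x0 ->
  exists T : cantor -> option cantor,
    [/\ ae_computable (fair_coin R) T,
        measure_preserving (fair_coin R) mu T
      & ppreimage T [set x0] = set0].
Proof.
move=> cmu nrand.
have [t [nu [tl cnu tnu tx0]]] : exists t, exists nu : probability cantor R,
    [/\ lower_semicomputable t, computable_measure nu,
        (forall s, \int[mu]_(y in cyl s) t y <= nu (cyl s))%E & ~ (t x0 < +oo)%E].
  apply: contrapT => nex; apply: nrand => t nu tl cnu tnu.
  by apply: contrapT => tx; apply: nex; exists t, nu.
have [gm [cgm gmP]] := computable_measure_approx cmu.
have [gn [cgn gnP]] := computable_measure_approx cnu.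
pose m s := fine (mu (cyl s)); pose n s := fine (nu (cyl s)).
have mP : prob_on_strings m := fine_probability_prob_on_strings mu.
have nP : prob_on_strings n := fine_probability_prob_on_strings nu.
have sound := prefix_test_sound mP nP gmP gnP.
have complete := prefix_test_complete mP nP gmP gnP.
have rP := reach_measure nP sound complete.
exists (limit_map (prefix_test gm gn)); split.
- apply: (limit_map_ae_computable mP rP).
  exact: computable_out_machine.
- apply: (limit_map_preserving mP rP) => s.
  by rewrite fineK // fin_num_measure //; exact: measurable_cyl.
apply/seteqP; split => // z [_ -> /limit_mapP zx0].
(* Length N + 1 makes the output nonempty, which rules out the uncertified case of
   [out_certified]. *)
have certN N : exists j,
    [/\ prefix (restr x0 N.+1) (out (prefix_test gm gn) (restr z j)) &
    certified m n (restr z j) (out (prefix_test gm gn) (restr z j))].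
  have /(out_machine_lim_cyl _ zx0)[j uj] : cyl (restr x0 N.+1) x0.
    by rewrite cylE size_restr.
  exists j; split => //; have [oj|//] := out_certified sound (restr z j).
  by have := size_prefix uj; rewrite oj size_restr.
(* A first certificate shows that [z] contains a one. This fixes the level k, and only then is the
   factor 2^(k+1) chosen. *)
have [j1 [_ [k1 _ _]]] := certN 0%N.
set k := find id (restr z j1) in k1.
have C0 : 0 <= 2 ^+ k.+1 :> R by rewrite exprn_ge0.
have [N NP] := lower_semicomputable_blowup tl tx0 C0 tnu.
have [j [uj [kj lo_val val_hi]]] := certN N.
(* Both certified prefixes of [z] contain a one, so their first one is the same. *)
have kE : find id (restr z j) = k.
  case: (leqP j j1) => [jj|/ltnW jj].
    by rewrite -(find_prefix (prefix_restr z jj) kj).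
  by rewrite (find_prefix (prefix_restr z jj) k1).
have [lo_u hi_u] := itv_prefix mP nP k
  (prefix_trans (prefix_restr x0 (leqnSn N)) uj).
have : m (restr x0 N) <= level R k.+1 * n (restr x0 N).
  by rewrite /level ler_pdivlMl ?exprn_gt0.
(* A dyadic interval of positive length would lie in the empty interval of [restr x0 N]. *)
move=> /(itv_empty mP nP); have := level_gt0 R (size (restr z j)).
by rewrite kE in lo_val val_hi; lra.
Qed.
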